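(* There exist separable Hopf Galois field extensions $K/k$ such that the Galois correspondence is not bijective for any of the Hopf Galois structures of $K/k$.
   Context: A finite extension $K/k$ is Hopf Galois if there is a finite cocommutative $k$-Hopf algebra $H$ such that $K$ is an $H$-module algebra and the $k$-linear map $j:K\otimes_kH\to\mathrm{End}_k(K)$, $j(s\otimes h)(t)=s(ht)$, is bijective; $H$ with its action is a Hopf Galois structure on $K/k$. For such a structure, with counit $\varepsilon$, the Galois correspondence is the map sending a sub-Hopf algebra $H'$ of $H$ to the intermediate field $K^{H'}=\{x\in K: h\cdot x=\varepsilon(h)x\ \forall h\in H'\}$ of $K/k$; it is always injective, and it is bijective if every intermediate field of $K/k$ is in its image. *)

(* Defs.v *)
From HB Require Import structures.
From mathcomp Require Import all_boot all_order all_fingroup all_algebra all_field.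

Set Implicit Arguments.
Unset Strict Implicit.
Unset Printing Implicit Defensive.

Import GRing.Theory.
Local Open Scope ring_scope.

(* The tensor product U (x) V of finite-dimensional vector spaces, realised as
   the space of coefficient matrices in the bases [vbasis {:U}] and [vbasis {:V}].  The
   lemmas [tlift_tmul] and [tlift_uniq] are its universal property. *)
Section Tensor.

Variable k : fieldType.

Definition tens (U V : vectType k) : vectType k :=
  'M[k]_(\dim {:U}, \dim {:V}).

Definition tmul (U V : vectType k) (u : U) (v : V) : tens U V :=
  \matrix_(i, j) (coord (vbasis {:U}) i u * coord (vbasis {:V}) j v).

(* The linear map U (x) V -> W induced by f : U -> V -> W.  It is only
   meaningful for bilinear f. *)
Definition tlift (U V W : vectType k) (f : U -> V -> W) (t : tens U V) : W :=
  \sum_i \sum_j (t : 'M_(_, _)) i j *: f (vbasis {:U})`_i (vbasis {:V})`_j.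

Definition bilinear_fun (U V W : vectType k) (f : U -> V -> W) : Prop :=
  (forall u, linear (f u)) /\ (forall v, linear (f^~ v)).

Lemma tmul_bilinear (U V : vectType k) : bilinear_fun (@tmul U V).
Proof.
split=> [u|v] a x y; apply/matrixP=> i j; rewrite !mxE linearP.
  by rewrite mulrDr [in LHS]mulrCA.
by rewrite mulrDl -mulrA.
Qed.

Lemma tlift_is_linear (U V W : vectType k) (f : U -> V -> W) :
  linear (tlift f).
Proof.
move=> a s t; rewrite /tlift scaler_sumr -big_split; apply: eq_bigr => i _.
rewrite scaler_sumr -big_split; apply: eq_bigr => j _.
by rewrite !mxE scalerDl scalerA.
Qed.

HB.instance Definition _ (U V W : vectType k) (f : U -> V -> W) :=
  GRing.isLinear.Build k (tens U V) W _ (tlift f) (tlift_is_linear f).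

Lemma tlift_tmul (U V W : vectType k) (f : U -> V -> W) :
  bilinear_fun f -> forall u v, tlift f (tmul u v) = f u v.
Proof.
case=> fr fl u v.
pose Fr u := GRing.isLinear.Build k V W _ (f u) (fr u).
pose Fl v := GRing.isLinear.Build k U W _ (f^~ v) (fl v).
pose gr u : {linear V -> W} := HB.pack (f u) (Fr u).
pose gl v : {linear U -> W} := HB.pack (f^~ v) (Fl v).
rewrite -[f u v]/(gl v u) [in RHS](coord_vbasis (memvf u)) linear_sum.
apply: eq_bigr => i _; rewrite linearZ /= -[f _ v]/(gr (vbasis {:U})`_i v).
rewrite [in RHS](coord_vbasis (memvf v)) linear_sum scaler_sumr.
by apply: eq_bigr => j _; rewrite linearZ /= scalerA mxE.
Qed.

Lemma tlift_uniq (U V W : vectType k) (f : U -> V -> W)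
    (g : {linear tens U V -> W}) :
  (forall u v, g (tmul u v) = f u v) -> g =1 tlift f.
Proof.
move=> gE t; rewrite [t in LHS]matrix_sum_delta linear_sum.
apply: eq_bigr => i _; rewrite linear_sum; apply: eq_bigr => j _.
rewrite linearZ -gE; congr (_ *: g _); apply/matrixP=> i' j'.
have freeb (X : vectType k) := basis_free (vbasisP {:X}).
by rewrite !mxE !coord_free ?freeb // -natrM mulnb (eq_sym i) (eq_sym j).
Qed.

Definition tens_map (U V U' V' : vectType k) (f : U -> U') (g : V -> V') :
    tens U V -> tens U' V' :=
  tlift (fun u v => tmul (f u) (g v)).

Definition tens_swap (U V : vectType k) : tens U V -> tens V U :=
  tlift (fun u v => tmul v u).

Definition tens_assoc (U V W : vectType k) :
    tens (tens U V) W -> tens U (tens V W) :=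
  tlift (fun t w => tlift (fun u v => tmul u (tmul v w)) t).

(* The product of the algebra A (x) B: (a (x) b)(a' (x) b') = aa' (x) bb'. *)
Definition tens_mul (A B : falgType k) (s t : tens A B) : tens A B :=
  tlift (fun a b => tlift (fun a' b' => tmul (a * a') (b * b')) t) s.

Definition tens_sub (U V : vectType k) (A : {vspace U}) (B : {vspace V}) :
    {vspace tens U V} :=
  <<[seq tmul a b | a <- vbasis A, b <- vbasis B]>>%VS.

End Tensor.

Record hopfAlgebra (k : fieldType) := HopfAlgebra {
  hopf_alg :> falgType k;
  comul : 'Hom(hopf_alg, tens hopf_alg hopf_alg);
  counit : 'Hom(hopf_alg, k^o);
  antipode : 'Hom(hopf_alg, hopf_alg);
  comulA : forall h, tens_assoc (tens_map comul id (comul h)) =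
                     tens_map id comul (comul h);
  counitl : forall h, tlift (fun a b => (counit a : k) *: b) (comul h) = h;
  counitr : forall h, tlift (fun a b => (counit b : k) *: a) (comul h) = h;
  comul1 : comul 1 = tmul 1 1;
  comulM : forall g h, comul (g * h) = tens_mul (comul g) (comul h);
  counit1 : counit 1 = 1;
  counitM : forall g h, counit (g * h) = counit g * counit h;
  antipodel : forall h,
    tlift (fun a b => antipode a * b) (comul h) = (counit h : k)%:A;
  antipoder : forall h,
    tlift (fun a b => a * antipode b) (comul h) = (counit h : k)%:A
}.

Definition cocommutative (k : fieldType) (H : hopfAlgebra k) : Prop :=
  forall h : H, tens_swap (comul H h) = comul H h.

Definition sub_hopf_algebra (k : fieldType) (H : hopfAlgebra k)
    (A : {vspace H}) : Prop :=
  [/\ 1 \in A,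
      (A * A <= A)%VS,
      (comul H @: A <= tens_sub A A)%VS &
      (antipode H @: A <= A)%VS].

Definition module_algebra (k : fieldType) (H : hopfAlgebra k) (K : falgType k)
    (act : 'Hom(H, 'End(K))) : Prop :=
  [/\ act 1 = \1%VF,
      forall g h : H, act (g * h) = (act g \o act h)%VF,
      forall h : H, act h 1 = (counit H h : k)%:A &
      forall (h : H) (x y : K),
        act h (x * y) = tlift (fun a b => act a x * act b y) (comul H h)].

(* j (s (x) h) (t) = s * (h . t) *)
Definition hopf_galois_map (k : fieldType) (H : hopfAlgebra k) (K : falgType k)
    (act : 'Hom(H, 'End(K))) : tens K H -> 'End(K) :=
  tlift (fun (s : K) (h : H) => (amull s \o act h)%VF).

Record hopfGaloisStructure (k : fieldType) (K : fieldExtType k) :=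
  HopfGaloisStructure {
    hgs_hopf :> hopfAlgebra k;
    hgs_act : 'Hom(hgs_hopf, 'End(K));
    hgs_cocommutative : cocommutative hgs_hopf;
    hgs_module_algebra : module_algebra hgs_act;
    hgs_bijective : bijective (hopf_galois_map hgs_act)
  }.

Definition hopf_galois (k : fieldType) (K : fieldExtType k) : Prop :=
  inhabited (hopfGaloisStructure K).

(* The fixed space K^A.  It suffices to impose the condition on a basis of A;
   see [hopf_fixedP]. *)
Definition hopf_fixed (k : fieldType) (K : fieldExtType k)
    (S : hopfGaloisStructure K) (A : {vspace S}) : {vspace K} :=
  (\bigcap_(h <- vbasis A)
     lker (hgs_act S h - (counit S h : k) *: \1%VF))%VS.

Lemma hopf_fixedP (k : fieldType) (K : fieldExtType k)
    (S : hopfGaloisStructure K) (A : {vspace S}) (x : K) :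
  x \in hopf_fixed A <->
  (forall h : S, h \in A -> hgs_act S h x = (counit S h : k) *: x).
Proof.
have kerE h : (x \in lker (hgs_act S h - (counit S h : k) *: \1%VF)) =
              (hgs_act S h x == (counit S h : k) *: x).
  by rewrite memv_ker add_lfunE opp_lfunE scale_lfunE id_lfunE subr_eq0.
have capE (s : seq S) :
  (x \in (\bigcap_(h <- s) lker (hgs_act S h - (counit S h : k) *: \1%VF))%VS)
  = all (fun h => hgs_act S h x == (counit S h : k) *: x) s.
  by elim: s => [|h s IHs]; rewrite ?big_nil ?memvf // big_cons memv_cap kerE IHs.
rewrite /hopf_fixed capE; split=> [/allP fixA h hA | fixA]; last first.
  by apply/allP => h /vbasis_mem/fixA ->.
rewrite (coord_vbasis hA) !linear_sum sum_lfunE scaler_suml.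
apply: eq_bigr => i _; rewrite !linearZ scale_lfunE.
have /fixA/eqP -> : (vbasis A)`_i \in vbasis A.
  by rewrite mem_nth // size_tuple.
by rewrite scalerA.
Qed.

(* The correspondence A |-> K^A from sub-Hopf algebras to intermediate fields
   is always injective, so its bijectivity amounts to every intermediate field
   being in its image. *)
Definition galois_correspondence_bijective (k : fieldType) (K : fieldExtType k)
    (S : hopfGaloisStructure K) : Prop :=
  forall F : {subfield K},
    exists A : {vspace S}, sub_hopf_algebra A /\ hopf_fixed A = F.

(* Main.v *)
Require Import Defs.
From HB Require Import structures.
From mathcomp Require Import all_boot all_order all_fingroup all_algebra all_field.
From mathcomp Require Import ring lra.

(** The example is K = Q(i, v) with v^3 = 1 + sqrt 3, an extension of Q of degree
    12.  Put omega = exp(2 i pi / 3), and let nu be a cube root of -2, the product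
    of 1 + sqrt 3 and its conjugate.  The Galois closure of K is L = K(nu), of
    degree 36, with group G = S3 x S3; the conjugates of v are the omega^j v and
    the omega^j nu / v.  The automorphisms of K form a group Gamma = S3 with fixed
    field Q(sqrt 3).

    K is Hopf Galois.  Let E = Q(sqrt 3, i), so that K is the sum of E, E v and
    E v^2.  An automorphism g of E that fixes sqrt 3 acts on K by fixing v, and
    composing with the three projections gives three operators on K.  If g moves
    sqrt 3 there is no such extension, since nu is not in K, but sending f v^m to
    g(f) v^-m times a power of nu that is rational still makes sense on each
    component.  The resulting 12 operators (twisted_op) are closed under
    composition, and expand a product of two elements of K in terms of one
    another (twisted_op_mul); this makes their span a Hopf algebra, because the
    axioms can be tested on operators (hopf_galois_of_operators).

    No Hopf Galois structure on K has a bijective correspondence.  Over L, such a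
    structure is given by a group N of permutations of the 12 embeddings of K in
    L, which is simply transitive and normalised by the Galois group (Greither and
    Pareigis).  This is proved here in terms of the table of coefficients of the
    embeddings composed with the elements of the Hopf algebra
    (coefficient_transfer, coefficient_comp).  If the fixed field F of an
    involution rho of K is in the image of the correspondence, some element of N
    other than 1 preserves the pairs of embeddings that agree on F
    (coefficient_support, coefficient_nontrivial), and so it is composition with
    rho.  Thus a bijective correspondence forces N to contain Gamma, which has
    three such involutions.  Let now sigma be the automorphism of L over K with
    sigma(nu) = omega nu.  Conjugation by sigma preserves N and is trivial on
    Gamma; as Gamma is normal in N, of index 2, and has no centre, it is trivial
    on N.  But an element of N outside Gamma takes the inclusion of K in L to an
    embedding with v |-> omega^j nu / v, which sigma moves
    (no_bijective_correspondence). *)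

Set Implicit Arguments.
Unset Strict Implicit.
Unset Printing Implicit Defensive.

Import GRing.Theory Num.Theory.
Local Open Scope ring_scope.

(** * Linear algebra over a field extension *)

(** Subtracting chi i0 y times a relation from its value at y * x kills the
    term of index i0, and keeps the term of index j if y separates chi j from
    chi i0. *)
Lemma dedekind_independence (I : finType) (A : nzRingType) (F : fieldType)
    (chi : I -> {rmorphism A -> F}) :
    (forall i j, i != j -> exists a, chi i a != chi j a) ->
  forall c : I -> F, (forall x, \sum_i c i * chi i x = 0) -> forall i, c i = 0.
Proof.
move=> chi_neq c; have [n] := ubnP #|[set i | c i != 0]|.
elim: n c => // n IHn c lt_n c0 i0; apply/eqP/negPn/negP => ci0.
have cj0 j : j != i0 -> c j = 0.
  move=> ji0; have [y chiy] := chi_neq j i0 ji0.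
  pose b i := c i * (chi i y - chi i0 y).
  have : b j = 0; last first.
    by move/eqP; rewrite mulf_eq0 subr_eq0 (negPf chiy) orbF => /eqP.
  apply: IHn => [|x]; last first.
    transitivity (\sum_i c i * chi i (y * x)
                  - chi i0 y * \sum_i c i * chi i x); last first.
      by rewrite !c0 mulr0 subrr.
    rewrite mulr_sumr -sumrB; apply: eq_bigr => i _.
    by rewrite rmorphM /b; ring.
  apply: leq_trans (ltnSE lt_n); apply: proper_card; apply/properP; split.
    by apply/subsetP => i; rewrite !inE /b mulf_eq0 negb_or => /andP[].
  by exists i0; rewrite ?inE // /b subrr mulr0 eqxx.
have := c0 1; rewrite (bigD1 i0) //= big1 => [|j /cj0->]; last by rewrite mul0r.
by rewrite addr0 rmorph1 mulr1; apply/eqP.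
Qed.

(** The map sending c to the combination of the f i with coefficients c is
    injective and k-linear between spaces of the same dimension over k; no
    vector space over L has to be formed. *)
Lemma hom_field_basis (k : fieldType) (V : vectType k) (L : fieldExtType k)
    (I : finType) (f : I -> 'Hom(V, L)) :
    #|I| = \dim {:V} ->
    (forall c : I -> L, (forall t, \sum_i c i * f i t = 0) ->
      forall i, c i = 0) ->
  forall h : 'Hom(V, L), exists c : I -> L, forall t, h t = \sum_i c i * f i t.
Proof.
move=> cardI f_free h.
pose Phi (c : {ffun I -> L}) : 'Hom(V, L) := \sum_i (amull (c i) \o f i)%VF.
have PhiE c t : Phi c t = \sum_i c i * f i t.
  rewrite /Phi sum_lfunE; apply: eq_bigr => i _.
  by rewrite comp_lfunE lfunE.
have Phi_lin : linear Phi.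
  move=> a c d; apply/lfunP => t; rewrite add_lfunE scale_lfunE !PhiE.
  rewrite scaler_sumr -big_split; apply: eq_bigr => i _ /=.
  by rewrite !ffunE mulrDl scalerAl.
pose PhiL := GRing.isLinear.Build k {ffun I -> L} 'Hom(V, L) _ Phi Phi_lin.
pose P : {linear {ffun I -> L} -> 'Hom(V, L)} := HB.pack Phi PhiL.
have kerP : lker (linfun P) = 0%VS.
  apply/eqP; rewrite -subv0; apply/subvP => c.
  rewrite memv_ker memv0 lfunE => /eqP/lfunP Pc0.
  apply/eqP/ffunP => i; rewrite ffunE; apply: f_free => t.
  by rewrite -PhiE [LHS]Pc0 lfunE.
have imP : limg (linfun P) = fullv.
  apply/eqP; rewrite eqEdim subvf /=.
  have := limg_ker_dim (linfun P) fullv; rewrite kerP capv0 dimv0 add0n => ->.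
  by rewrite !dimvf in cardI *; rewrite [dim _]/= /dim /= cardI.
have /memv_imgP[c _ hE] : h \in limg (linfun P) by rewrite imP memvf.
by exists c => t; rewrite hE lfunE [LHS]PhiE.
Qed.

Lemma linear_lfun (k : fieldType) (V W : vectType k) (f : V -> W) :
  linear f -> exists F : 'Hom(V, W), forall v, F v = f v.
Proof.
move=> f_lin; pose fM := GRing.isLinear.Build k V W _ f f_lin.
pose fL : {linear V -> W} := HB.pack f fM.
by exists (linfun fL) => v; rewrite lfunE.
Qed.

Lemma dim_Hom (k : fieldType) (U V : vectType k) :
  \dim {:'Hom(U, V)} = (\dim {:U} * \dim {:V})%N.
Proof. by rewrite !dimvf. Qed.

Lemma dim_tens (k : fieldType) (U V : vectType k) :
  \dim {:tens U V} = (\dim {:U} * \dim {:V})%N.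
Proof. by rewrite dimvf. Qed.

(** * Linear maps out of tensor products *)

Section TliftLemmas.

Variables (k : fieldType) (U V : vectType k).

Lemma eq_tlift (W : vectType k) (f g : U -> V -> W) t :
  (forall u v, f u v = g u v) -> tlift f t = tlift g t.
Proof.
by move=> fg; apply: eq_bigr => i _; apply: eq_bigr => j _; rewrite fg.
Qed.

Lemma linear_tlift (W W' : vectType k) (l : {linear W -> W'})
    (f : U -> V -> W) t :
  l (tlift f t) = tlift (fun u v => l (f u v)) t.
Proof.
rewrite linear_sum; apply: eq_bigr => i _.
by rewrite linear_sum; apply: eq_bigr => j _; rewrite linearZ.
Qed.

Lemma tlift_sum (W : vectType k) (J : finType) (f : J -> U -> V -> W) t :
  tlift (fun u v => \sum_j f j u v) t = \sum_j tlift (f j) t.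
Proof.
rewrite /tlift [RHS]exchange_big /=; apply: eq_bigr => i _.
rewrite [RHS]exchange_big /=; apply: eq_bigr => j _.
by rewrite scaler_sumr.
Qed.

Lemma tlift0 (W : vectType k) t : tlift (fun (_ : U) (_ : V) => 0 : W) t = 0.
Proof. by apply: big1 => i _; apply: big1 => j _; rewrite scaler0. Qed.

Lemma tlift_mull (L : falgType k) (f : U -> V -> L) a t :
  tlift (fun u v => a * f u v) t = a * tlift f t.
Proof.
have aE b : a * b = amull a b by rewrite lfunE.
by rewrite aE linear_tlift; apply: eq_tlift => u v.
Qed.

Lemma tlift_mulr (L : falgType k) (f : U -> V -> L) a t :
  tlift (fun u v => f u v * a) t = tlift f t * a.
Proof.
have aE b : b * a = amulr a b by rewrite lfunE.
by rewrite aE linear_tlift; apply: eq_tlift => u v.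
Qed.

Lemma tlift_lfun (W W' : vectType k) (f : U -> V -> 'Hom(W, W')) t w :
  tlift f t w = tlift (fun u v => f u v w) t.
Proof.
rewrite sum_lfunE; apply: eq_bigr => i _; rewrite sum_lfunE.
by apply: eq_bigr => j _; rewrite scale_lfunE.
Qed.

End TliftLemmas.


Lemma tlift_exchange (k : fieldType) (U V U' V' W : vectType k)
    (f : U -> V -> U' -> V' -> W) s t :
  tlift (fun a b => tlift (f a b) t) s =
  tlift (fun a' b' => tlift (fun a b => f a b a' b') s) t.
Proof.
rewrite /tlift; under eq_bigr => i _ do under eq_bigr => j _ do
  (rewrite scaler_sumr; under eq_bigr => i' _ do rewrite scaler_sumr).
under [RHS]eq_bigr => i _ do under eq_bigr => j _ do
  (rewrite scaler_sumr; under eq_bigr => i' _ do rewrite scaler_sumr).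
under eq_bigr => i _ do rewrite exchange_big /=.
rewrite exchange_big /=; apply: eq_bigr => i' _.
under eq_bigr => i _ do rewrite exchange_big /=.
rewrite exchange_big /=; apply: eq_bigr => j' _.
apply: eq_bigr => i _; apply: eq_bigr => j _.
by rewrite !scalerA mulrC.
Qed.

Lemma tlift_param_linear (k : fieldType) (P U V W : vectType k)
    (F : P -> U -> V -> W) t :
  (forall u v, linear (fun p => F p u v)) -> linear (fun p => tlift (F p) t).
Proof.
move=> F_lin a p q; rewrite /tlift scaler_sumr -big_split; apply: eq_bigr => i _.
rewrite scaler_sumr -big_split; apply: eq_bigr => j _ /=.
by rewrite F_lin scalerDr !scalerA mulrC.
Qed.

Lemma coord_fullv_eq0 (k : fieldType) (V : vectType k) (v : V) :
  (forall i, coord (vbasis {:V}) i v = 0) -> v = 0.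
Proof.
move=> v0; rewrite (coord_vbasis (memvf v)) big1 // => i _.
by rewrite v0 scale0r.
Qed.

Lemma vbasis_comb_eq0 (k : fieldType) (V : vectType k)
    (a : 'I_(\dim {:V}) -> k) :
  \sum_i a i *: (vbasis {:V})`_i = 0 -> forall i, a i = 0.
Proof. exact/freeP/basis_free/vbasisP. Qed.

Section Evaluation.

Variables (k : fieldType) (U V : vectType k) (u : U).

Definition lfun_eval (f : 'Hom(U, V)) : V := f u.

Fact lfun_eval_linear : linear lfun_eval.
Proof. by move=> a f g; rewrite /lfun_eval add_lfunE scale_lfunE. Qed.

HB.instance Definition _ :=
  GRing.isLinear.Build k 'Hom(U, V) V _ lfun_eval lfun_eval_linear.

End Evaluation.

(** * Hopf algebras of operators on a field *)

Section FaithfulAction.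

Variables (k : fieldType) (K : fieldExtType k) (H : falgType k).
Variable act : 'Hom(H, 'End(K)).

Definition action_map : tens K H -> 'End(K) :=
  tlift (fun (s : K) (h : H) => (amull s \o act h)%VF).

Hypothesis act1 : act 1 = \1%VF.
Hypothesis actM : forall g h, act (g * h) = (act g \o act h)%VF.
Hypothesis act_free : injective action_map.

Let evl (x : K) : 'Hom(H, K) := (linfun (@lfun_eval k K K x) \o act)%VF.

Let evlE x h : evl x h = act h x.
Proof. by rewrite comp_lfunE lfunE. Qed.

Lemma action_map_tmul s h x : action_map (tmul s h) x = s * act h x.
Proof.
rewrite /action_map tlift_tmul; first by rewrite comp_lfunE lfunE.
split=> [a|a] e v w; first by rewrite linearP comp_lfunDr comp_lfunZr.
by rewrite linearP comp_lfunDl comp_lfunZl.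
Qed.

Lemma action_map_linear : linear action_map.
Proof. exact: linearP. Qed.

Lemma bilinear_act_mul (W : vectType k) (f : 'Hom(W, K)) x :
  bilinear_fun (fun h w => act h x * f w).
Proof.
split=> [h|w] a u v; first by rewrite linearP mulrDr scalerAr.
by rewrite linearP add_lfunE scale_lfunE mulrDl scalerAl.
Qed.

(** Since K (x) H embeds in End(K), a tensor in H (x) W is determined by the
    operators that it induces as soon as W is faithfully represented by maps to
    K.  For W = H and W = H (x) H this reduces the Hopf algebra axioms to
    identities between operators. *)
Lemma act_tens_faithful (W : vectType k) (Y : Type) (ev : Y -> 'Hom(W, K)) :
    (forall w, (forall y, ev y w = 0) -> w = 0) ->
  forall s t : tens H W,
    (forall x y, tlift (fun h w => act h x * ev y w) s =
                 tlift (fun h w => act h x * ev y w) t) ->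
  s = t.
Proof.
move=> ev_inj s t st; apply/eqP; rewrite -subr_eq0; apply/eqP.
have {st} : forall x y, tlift (fun h w => act h x * ev y w) (s - t) = 0.
  by move=> x y; rewrite linearB /= st subrr.
move: (s - t) => {s}t t0.
pose r i : W := \sum_j (t : 'M_(_, _)) i j *: (vbasis {:W})`_j.
have r0 i : r i = 0.
  apply: ev_inj => y.
  pose u : tens K H := \sum_i tmul (ev y (r i)) (vbasis {:H})`_i.
  have u0 : u = 0.
    apply: act_free; apply/lfunP => x; rewrite [in RHS]/action_map linear0 lfunE.
    rewrite /u /action_map linear_sum sum_lfunE -[RHS](t0 x y).
    apply: eq_bigr => q _ /=; rewrite -/(action_map _) action_map_tmul.
    rewrite /r linear_sum mulr_suml.
    by apply: eq_bigr => j _; rewrite linearZ /= -scalerAl mulrC.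
  apply: coord_fullv_eq0 => p.
  have /(congr1 (fun m : 'M_(_, _) => m p i)) := u0.
  rewrite mxE summxE => <-; rewrite (bigD1 i) //= big1 ?addr0 => [|q qi].
    by rewrite mxE coord_free ?(basis_free (vbasisP _)) // eqxx mulr1.
  rewrite mxE coord_free ?(basis_free (vbasisP _)) //.
  by rewrite (negPf qi) mulr0.
apply/matrixP => i j; rewrite mxE.
by move: j; apply: vbasis_comb_eq0; apply: r0.
Qed.

Lemma act_inj : injective act.
Proof.
move=> g h gh; apply/eqP; rewrite -subr_eq0; apply/eqP.
have tgh : tmul (1 : K) (g - h) = 0.
  apply: act_free; apply/lfunP => x; rewrite [in RHS]/action_map linear0 lfunE.
  by rewrite action_map_tmul linearB /= gh subrr lfunE mulr0.
apply: coord_fullv_eq0 => j; apply/eqP/negPn/negP => j0.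
suff /eqP : 1 = 0 :> K by rewrite oner_eq0.
apply: coord_fullv_eq0 => p.
have /(congr1 (fun m : 'M_(_, _) => m p j)) := tgh.
by rewrite !mxE => /eqP; rewrite mulf_eq0 (negPf j0) orbF => /eqP.
Qed.

Variable Delta : 'Hom(H, tens H H).
Hypothesis DeltaE : forall h x y,
  act h (x * y) = tlift (fun a b => act a x * act b y) (Delta h).
Variable eps : 'Hom(H, k^o).
Hypothesis epsE : forall h, act h 1 = (eps h : k)%:A.
Variable anti : 'Hom(H, H).
Hypothesis antil : forall h x,
  tlift (fun a b => act (anti a) (act b x)) (Delta h) = (eps h : k) *: x.
Hypothesis antir : forall h x,
  tlift (fun a b => act a (act (anti b) x)) (Delta h) = (eps h : k) *: x.

Let ev2 (y : K * K) : 'Hom(tens H H, K) :=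
  linfun (tlift (fun a b => evl y.1 a * evl y.2 b)).

Let ev2E y t : ev2 y t = tlift (fun a b => act a y.1 * act b y.2) t.
Proof. by rewrite lfunE; apply: eq_tlift => a b; rewrite !evlE. Qed.

Let ev2_tmul y a b : ev2 y (tmul a b) = act a y.1 * act b y.2.
Proof.
rewrite -(evlE y.2 b) -(tlift_tmul (bilinear_act_mul (evl y.2) y.1)) ev2E.
by apply: eq_tlift => ? ?; rewrite evlE.
Qed.

Let ev2_Delta x y h : ev2 (x, y) (Delta h) = act h (x * y).
Proof. by rewrite ev2E DeltaE. Qed.

Let ev_inj h : (forall y, evl y h = 0) -> h = 0.
Proof.
move=> h0; apply: act_inj; apply/lfunP => y.
by rewrite linear0 lfunE -evlE h0.
Qed.

Let tens2_eq (s t : tens H H) : (forall y, ev2 y s = ev2 y t) -> s = t.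
Proof.
move=> st; apply: (act_tens_faithful ev_inj) => x y.
have := st (x, y); rewrite !ev2E /= => H0.
by under eq_tlift => a b do rewrite evlE; under [RHS]eq_tlift => a b do rewrite evlE.
Qed.

Let ev2_inj t : (forall y, ev2 y t = 0) -> t = 0.
Proof. by move=> t0; apply: tens2_eq => y; rewrite t0 linear0. Qed.

Fact action_comulA h : tens_assoc (tens_map Delta id (Delta h)) =
                       tens_map id Delta (Delta h).
Proof.
apply: (act_tens_faithful ev2_inj) => x y.
pose e3 : tens H (tens H H) -> K := tlift (fun a u => act a x * ev2 y u).
rewrite -/(e3 _) -/(e3 _).
have e3_tmul a u : e3 (tmul a u) = act a x * ev2 y u.
  by rewrite /e3 tlift_tmul //; apply: bilinear_act_mul.
transitivity (act h (x * (y.1 * y.2))); last first.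
  rewrite /tens_map /e3 linear_tlift -/e3 DeltaE; apply: eq_tlift => a b.
  by rewrite [RHS]e3_tmul ev2E DeltaE.
have assoc_tmul t (b : H) : tens_assoc (tmul t b) =
    tlift (fun a' b' : H => tmul a' (tmul b' b)) t.
  have [bil1 bil2] := @tmul_bilinear k H (tens H H).
  have [bil3 bil4] := @tmul_bilinear k H H.
  rewrite /tens_assoc tlift_tmul //; split=> [u|v]; last exact: tlift_is_linear.
  apply: tlift_param_linear => a' b' e v w /=.
  by rewrite (bil3 b') (bil1 a').
have e3_lift (V' W' : vectType k) (F : V' -> W' -> tens H (tens H H)) t :
  e3 (tlift F t) = tlift (fun a b => e3 (F a b)) t by exact: linear_tlift.
rewrite mulrA DeltaE /tens_map.
have -> : tens_assoc (tlift (fun u v => tmul (Delta u) (id v)) (Delta h)) =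
  tlift (fun a b => tens_assoc (tmul (Delta a) b)) (Delta h).
  exact: linear_tlift.
rewrite e3_lift; apply: eq_tlift => a b; rewrite assoc_tmul e3_lift DeltaE.
rewrite -tlift_mulr; apply: eq_tlift => a' b'.
by rewrite e3_tmul ev2_tmul mulrA.
Qed.

Let alg_inj : injective (fun a : k => a%:A : K).
Proof. exact: (fmorph_inj (in_alg K)). Qed.

Fact action_counitl h : tlift (fun a b => (eps a : k) *: b) (Delta h) = h.
Proof.
apply: act_inj; apply/lfunP => y; rewrite -[in RHS](mul1r y) DeltaE.
rewrite linear_tlift tlift_lfun; apply: eq_tlift => a b.
by rewrite linearZ scale_lfunE epsE mulr_algl.
Qed.

Fact action_cocommutative h : tens_swap (Delta h) = Delta h.
Proof.
apply: tens2_eq => -[x y]; rewrite ev2_Delta mulrC DeltaE.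
rewrite /tens_swap linear_tlift; apply: eq_tlift => a b.
by rewrite /= ev2_tmul mulrC.
Qed.

Fact action_counitr h : tlift (fun a b => (eps b : k) *: a) (Delta h) = h.
Proof.
apply: act_inj; apply/lfunP => y; rewrite -[in RHS](mulr1 y) DeltaE.
rewrite linear_tlift tlift_lfun; apply: eq_tlift => a b.
by rewrite linearZ scale_lfunE epsE mulr_algr.
Qed.

Fact action_comul1 : Delta 1 = tmul 1 1.
Proof.
by apply: tens2_eq => -[x y]; rewrite ev2_Delta ev2_tmul act1 !id_lfunE.
Qed.

Fact action_comulM g h : Delta (g * h) = tens_mul (Delta g) (Delta h).
Proof.
apply: tens2_eq => -[x y]; rewrite ev2_Delta actM comp_lfunE DeltaE.
rewrite /tens_mul !linear_tlift.
transitivity (tlift (fun a' b' => tlift (fun a b =>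
    act a (act a' x) * act b (act b' y)) (Delta g)) (Delta h)).
  by apply: eq_tlift => a' b'; rewrite /= DeltaE.
rewrite tlift_exchange; apply: eq_tlift => a b.
rewrite linear_tlift; apply: eq_tlift => a' b'.
by rewrite /= ev2_tmul !actM !comp_lfunE.
Qed.

Fact action_counit1 : eps 1 = 1.
Proof. by apply: alg_inj; rewrite -epsE act1 id_lfunE scale1r. Qed.

Fact action_counitM g h : eps (g * h) = eps g * eps h.
Proof.
apply: alg_inj => /=; rewrite -epsE actM comp_lfunE epsE linearZ /= epsE.
by rewrite scalerA mulrC.
Qed.

Fact action_antipodel h :
  tlift (fun a b => anti a * b) (Delta h) = (eps h : k)%:A.
Proof.
apply: act_inj; apply/lfunP => x.
rewrite [act (_ *: _)]linearZ scale_lfunE /= act1 id_lfunE.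
rewrite -antil linear_tlift tlift_lfun; apply: eq_tlift => a b.
by rewrite /= actM comp_lfunE.
Qed.

Fact action_antipoder h :
  tlift (fun a b => a * anti b) (Delta h) = (eps h : k)%:A.
Proof.
apply: act_inj; apply/lfunP => x.
rewrite [act (_ *: _)]linearZ scale_lfunE /= act1 id_lfunE.
rewrite -antir linear_tlift tlift_lfun; apply: eq_tlift => a b.
by rewrite /= actM comp_lfunE.
Qed.

Definition action_hopf : hopfAlgebra k :=
  HopfAlgebra action_comulA action_counitl action_counitr action_comul1
    action_comulM action_counit1 action_counitM action_antipodel
    action_antipoder.

(** The Galois map is injective by hypothesis, between two spaces of the same
    dimension. *)
Lemma hopf_galois_of_action : \dim {:H} = \dim {:K} -> hopf_galois K.
Proof.
move=> dimH; constructor.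
have modH : module_algebra (H := action_hopf) act by split.
have galH : bijective (hopf_galois_map (H := action_hopf) act).
  have [f fE] : exists f : 'Hom(tens K H, 'End(K)), forall t, f t = action_map t.
    exact/linear_lfun/action_map_linear.
  have kerf : lker f == 0%VS.
    by apply/lker0P => s t; rewrite !fE => /act_free.
  have imf : limg f = fullv.
    apply/eqP; rewrite eqEdim subvf /=.
    have := limg_ker_dim f fullv; rewrite (eqP kerf) capv0 dimv0 add0n => ->.
    by rewrite dim_Hom dim_tens dimH.
  exists (f^-1)%VF => t; first by rewrite -[hopf_galois_map _ _]fE lker0_lfunK.
  have /memv_imgP[u _ ->] : t \in limg f by rewrite imf memvf.
  by rewrite lker0_lfunK // -[LHS]fE.
exact: (HopfGaloisStructure (hgs_hopf := action_hopf) action_cocommutative modH galH).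
Qed.

End FaithfulAction.

Section OperatorAlgebra.

Variables (k : fieldType) (K : fieldExtType k) (I : finType).
Variable E : I -> 'End(K).
Hypothesis E_free : forall s : I -> K,
  (forall x, \sum_i s i * E i x = 0) -> forall i, s i = 0.
Hypothesis E_mul : forall i j, exists m : I -> k,
  forall x, E i (E j x) = \sum_l m l *: E l x.
Hypothesis E_one : exists e : I -> k, forall x, \sum_i e i *: E i x = x.

Local Notation V := {ffun I -> k^o}.

Lemma operators_lin_free (a b : I -> k) :
  (forall x, \sum_i a i *: E i x = \sum_i b i *: E i x) -> forall i, a i = b i.
Proof.
move=> ab i; apply/eqP; rewrite -subr_eq0; apply/eqP.
apply: (fmorph_inj (in_alg K)); rewrite rmorph0.
move: i; apply: E_free => x.
transitivity (\sum_i a i *: E i x - \sum_i b i *: E i x); last by rewrite ab subrr.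
rewrite -sumrB; apply: eq_bigr => i _.
by rewrite mulr_algl scalerBl.
Qed.

(** The span of the operators, as an algebra of coordinate vectors: the product
    is transported along the faithful action, and is composition in the usual
    order, whereas the product of 'End(K) as a falgType is its opposite.  The
    last two clauses say that the e i form a basis. *)
Lemma operator_algebra : exists (H : falgType k) (act : 'Hom(H, 'End(K)))
    (e : I -> H),
  [/\ act 1 = \1%VF, forall g h, act (g * h) = (act g \o act h)%VF,
      forall i, act (e i) = E i,
      \dim {:H} = #|I| &
      forall (W : vectType k) (f : I -> W),
        exists F : 'Hom(H, W), forall i, F (e i) = f i]
  /\ forall h : H, exists c : I -> k, h = \sum_i c i *: e i.
Proof.
have [o oE] := E_one.
have /fin_all_exists[m mE] (ij : I * I) := E_mul ij.1 ij.2.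
pose ap (v : V) : 'End(K) := \sum_i (v i : k) *: E i.
have apE v x : ap v x = \sum_i (v i : k) *: E i x.
  by rewrite sum_lfunE; apply: eq_bigr => i _; rewrite scale_lfunE.
have ap_lin : linear ap.
  move=> a u v; rewrite scaler_sumr -big_split; apply: eq_bigr => i _ /=.
  by rewrite !ffunE scalerA scalerDl.
have ap_inj : injective ap.
  move=> u v uv; apply/ffunP; apply: operators_lin_free => x.
  by rewrite -!apE uv.
pose mul (u v : V) : V := [ffun l => \sum_i \sum_j (u i : k) * v j * m (i, j) l].
have apM u v : ap (mul u v) = (ap u \o ap v)%VF.
  apply/lfunP => x; rewrite comp_lfunE !apE.
  transitivity (\sum_i \sum_j ((u i : k) * v j) *: E i (E j x)).
    under [RHS]eq_bigr => i _ do under eq_bigr => j _ do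
      (rewrite (mE (i, j)) scaler_sumr /=).
    under [RHS]eq_bigr => i _ do rewrite exchange_big /=.
    rewrite [RHS]exchange_big /=; apply: eq_bigr => l _.
    rewrite ffunE scaler_suml; apply: eq_bigr => i _.
    by rewrite scaler_suml; apply: eq_bigr => j _; rewrite scalerA.
  apply: eq_bigr => i _; rewrite linear_sum scaler_sumr.
  by apply: eq_bigr => j _; rewrite linearZ scalerA.
pose one : V := [ffun i => o i].
have ap1 : ap one = \1%VF.
  apply/lfunP => x; rewrite apE id_lfunE -[RHS]oE.
  by apply: eq_bigr => i _; rewrite ffunE.
pose vH : vectType k := V.
have apD u v : ap (u + v) = ap u + ap v.
  by rewrite -[u in LHS]scale1r ap_lin scale1r.
have mulA : associative (mul : vH -> vH -> vH).
  by move=> u v w; apply: ap_inj; rewrite !apM comp_lfunA.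
have mul1 : left_id (one : vH) mul.
  by move=> u; apply: ap_inj; rewrite apM ap1 comp_lfun1l.
have mul1' : right_id (one : vH) mul.
  by move=> u; apply: ap_inj; rewrite apM ap1 comp_lfun1r.
have mulDl : left_distributive (mul : vH -> vH -> vH) +%R.
  by move=> u v w; apply: ap_inj; rewrite !(apM, apD) comp_lfunDl.
have mulDr : right_distributive (mul : vH -> vH -> vH) +%R.
  by move=> u v w; apply: ap_inj; rewrite !(apM, apD) comp_lfunDr.
have ap0 : ap 0 = 0.
  by rewrite -(subrr (one : V)) -scaleN1r addrC ap_lin ap1 scaleN1r addNr.
have nz1 : (one : vH) != 0.
  apply: contraNneq (oner_neq0 K) => one0.
  by rewrite -[1](id_lfunE _) -ap1 one0 ap0 lfunE.
pose mulM := GRing.Zmodule_isNzRing.Build vH mulA mul1 mul1' mulDl mulDr nz1.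
pose rH : nzRingType := HB.pack vH mulM.
have apZ a u : ap (a *: u) = a *: ap u.
  by rewrite -[a *: u]addr0 ap_lin ap0 addr0.
have mulZl : GRing.Lmodule_isLalgebra k rH.
  constructor => a u v; apply: ap_inj; rewrite [LHS]apZ.
  by rewrite [X in _ *: X]apM [RHS]apM apZ comp_lfunZl.
pose lH : lalgType k := HB.pack rH mulZl.
have mulZr : GRing.Lalgebra_isAlgebra k lH.
  constructor => a u v; apply: ap_inj; rewrite [LHS]apZ.
  by rewrite [X in _ *: X]apM [RHS]apM apZ comp_lfunZr.
pose aH : algType k := HB.pack lH mulZr.
pose fM := Algebra_isFalgebra.Build k aH.
pose H : falgType k := HB.pack vH aH fM.
pose apL := GRing.isLinear.Build k H 'End(K) _ ap ap_lin.
pose apH : {linear H -> 'End(K)} := HB.pack ap apL.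
pose e i : H := ([ffun j => (i == j)%:R] : V).
exists H, (linfun apH), e; split; first split.
- by rewrite lfunE.
- by move=> g h; rewrite !lfunE; apply: apM.
- move=> i; rewrite lfunE; apply/lfunP => x; rewrite [LHS]apE.
  rewrite (bigD1 i) //= ffunE eqxx scale1r big1 ?addr0 // => j ji.
  by rewrite ffunE eq_sym (negPf ji) scale0r.
- by rewrite dimvf /= /dim /= muln1.
- move=> W f.
  have [F FE] : exists F : 'Hom(H, W), forall h, F h = \sum_i ((h : V) i : k) *: f i.
    apply: linear_lfun => a u v; rewrite scaler_sumr -big_split.
    by apply: eq_bigr => i _ /=; rewrite !ffunE scalerA scalerDl.
  exists F => i; rewrite FE.
  rewrite (bigD1 i) //= ffunE eqxx scale1r big1 ?addr0 // => j ji.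
  by rewrite ffunE eq_sym (negPf ji) scale0r.
move=> h; exists (h : V); apply/ffunP => j.
rewrite sum_ffunE (bigD1 j) //= !ffunE eqxx [_ *: _]mulr1 big1 ?addr0 // => i ij.
by rewrite !ffunE (negPf ij) [_ *: _]mulr0.
Qed.

(* In the basis E, d and eps are the structure constants of the
   comultiplication and of the counit, and the antipode is the permutation s. *)
Variables (d : I -> I -> I -> k) (eps : I -> k) (s : I -> I).
Hypothesis card_I : #|I| = \dim {:K}.
Hypothesis E_comul : forall i x y,
  E i (x * y) = \sum_a \sum_b d i a b *: (E a x * E b y).
Hypothesis E_counit : forall i, E i 1 = (eps i)%:A.
Hypothesis E_antil : forall i x,
  \sum_a \sum_b d i a b *: E (s a) (E b x) = eps i *: x.
Hypothesis E_antir : forall i x,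
  \sum_a \sum_b d i a b *: E a (E (s b) x) = eps i *: x.

Lemma hopf_galois_of_operators : hopf_galois K.
Proof.
have [H [act [e [[act1 actM acte dimH ext] gen]]]] := operator_algebra.
have [Delta DeltaE] := ext _ (fun i => \sum_a \sum_b d i a b *: tmul (e a) (e b)).
have [ep epE] := ext k^o eps.
have [S SE] := ext _ (fun i => e (s i)).
have free : injective (action_map act).
  have [f fE] : exists f : 'Hom(tens K H, 'End(K)), forall t, f t = action_map act t.
    exact/linear_lfun/action_map_linear.
  suff /lker0P fI : lker f == 0%VS by move=> t u tu; apply: fI; rewrite !fE.
  rewrite -subv0; apply/subvP => t; rewrite memv_ker memv0 fE => /eqP t0.
  have /fin_all_exists[c cE] (q : 'I_(\dim {:H})) := gen (vbasis {:H})`_q.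
  have tc0 p i : \sum_q (t : 'M_(_, _)) p q * c q i = 0.
    move: p; apply: vbasis_comb_eq0; move: i; apply: E_free => x.
    transitivity (action_map act t x); last by rewrite t0 lfunE.
    rewrite /action_map tlift_lfun /tlift; under eq_bigr => i _ do
      (rewrite mulr_suml; under eq_bigr => p _ do rewrite scaler_suml mulr_suml).
    rewrite exchange_big /=; apply: eq_bigr => p _.
    rewrite exchange_big /=; apply: eq_bigr => q _.
    rewrite comp_lfunE lfunE /= cE linear_sum sum_lfunE mulr_sumr scaler_sumr.
    apply: eq_bigr => i _; rewrite linearZ scale_lfunE /= acte.
    by rewrite -scalerA -!scalerAl -scalerAr.
  apply/eqP/matrixP => p q; rewrite mxE; move: q; apply: vbasis_comb_eq0.
  under eq_bigr => q _ do rewrite cE scaler_sumr.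
  rewrite exchange_big big1 //= => i _.
  under eq_bigr => q _ do rewrite scalerA.
  by rewrite -scaler_suml tc0 scale0r.
have ev_lin x : linear (fun h => act h x).
  by move=> a g h; rewrite linearP add_lfunE scale_lfunE.
have on_basis (f g : H -> K) : linear f -> linear g ->
    (forall i, f (e i) = g (e i)) -> forall h, f h = g h.
  move=> /linear_lfun[f' fE] /linear_lfun[g' gE] fg h.
  have [c ->] := gen h; rewrite -fE -gE !linear_sum; apply: eq_bigr => i _.
  by rewrite !linearZ /= fE gE fg.
have comul_lin (F : H -> H -> K) : linear (fun h => tlift F (Delta h)).
  by move=> a g h; rewrite linearP tlift_is_linear.
have comul_e (F : H -> H -> K) i : bilinear_fun F ->
    tlift F (Delta (e i)) = \sum_a \sum_b d i a b *: F (e a) (e b).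
  move=> bF; rewrite DeltaE linear_sum; apply: eq_bigr => a _.
  rewrite linear_sum; apply: eq_bigr => b _.
  by rewrite linearZ /= tlift_tmul.
have bil_mul x y : bilinear_fun (fun a b => act a x * act b y).
  split=> [a|b] c u v; first by rewrite ev_lin mulrDr scalerAr.
  by rewrite ev_lin mulrDl scalerAl.
have bil_comp (F G : 'End(H)) x : bilinear_fun (fun a b => act (F a) (act (G b) x)).
  split=> [a|b] c u v; last by rewrite linearP ev_lin.
  by rewrite linearP ev_lin linearP.
apply: (@hopf_galois_of_action _ _ _ act act1 actM free Delta _ ep _ S);
  last by rewrite dimH.
- move=> h x y; move: h; apply: on_basis => // i.
  rewrite comul_e // acte E_comul; apply: eq_bigr => a _; apply: eq_bigr => b _.
  by rewrite !acte.
- apply: on_basis => //; first by move=> a g h; rewrite linearP /= scalerDl scalerA.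
  by move=> i; rewrite acte epE E_counit.
- move=> h x; move: h; apply: on_basis => //.
    by move=> a g h; rewrite linearP /= scalerDl scalerA.
  move=> i; have bil := bil_comp S \1%VF x.
  transitivity (tlift (fun a b => act (S a) (act (\1%VF b) x)) (Delta (e i))).
    by apply: eq_tlift => a b; rewrite id_lfunE.
  rewrite comul_e // epE -E_antil; apply: eq_bigr => a _; apply: eq_bigr => b _.
  by rewrite id_lfunE SE !acte.
move=> h x; move: h; apply: on_basis => //.
  by move=> a g h; rewrite linearP /= scalerDl scalerA.
move=> i; have bil := bil_comp \1%VF S x.
transitivity (tlift (fun a b => act (\1%VF a) (act (S b) x)) (Delta (e i))).
  by apply: eq_tlift => a b; rewrite id_lfunE.
rewrite comul_e // epE -E_antir; apply: eq_bigr => a _; apply: eq_bigr => b _.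
by rewrite id_lfunE SE !acte.
Qed.

End OperatorAlgebra.

(** * The permutations behind a Hopf Galois structure *)

(** Over a field L that splits K, a Hopf Galois structure becomes the group
    algebra of a group N that permutes simply transitively the embeddings x i
    of K.  The composite of x i with the action of h is a combination of
    embeddings; its coefficient c i j h is the value at h of the functional dual
    to the element of N that moves x i to x j.  So c i j = c i' j' says that one
    element of N moves x i to x j and x i' to x j', and the properties of N are
    read off the table c, without descent. *)
Section CoefficientTable.

Variables (k : fieldType) (K L : fieldExtType k) (S : hopfGaloisStructure K).
Variables (I : finType) (x : I -> {lrmorphism K -> L}).
Hypothesis card_I : #|I| = \dim {:K}.
Hypothesis x_neq : forall i j, i != j -> exists a, x i a != x j a.

Local Notation act := (hgs_act S).

Lemma embeddings_free (c : I -> L) :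
  (forall t, \sum_i c i * x i t = 0) -> forall i, c i = 0.
Proof. exact: dedekind_independence. Qed.

Lemma embeddings_eq (c d : I -> L) :
  (forall t, \sum_i c i * x i t = \sum_i d i * x i t) -> forall i, c i = d i.
Proof.
move=> cd i; apply/eqP; rewrite -subr_eq0; apply/eqP.
move: i; apply: embeddings_free => t.
by under eq_bigr do rewrite mulrBl; rewrite sumrB cd subrr.
Qed.

(** Expanding the coordinate forms of K along the embeddings makes the
    coefficients visibly linear in h. *)
Lemma coefficient_table_exists : exists c : I -> I -> 'Hom(S, L),
  forall i h t, x i (act h t) = \sum_j c i j h * x j t.
Proof.
pose b := vbasis {:K}.
have /fin_all_exists[q qE] (j : 'I_(\dim {:K})) : exists q : I -> L,
    forall t, (coord b j t)%:A = \sum_y q y * x y t.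
  have [f fE] : exists f : 'Hom(K, L), forall t, f t = (coord b j t)%:A.
    by apply: linear_lfun => a u v; rewrite linearP /= scalerDl scalerA.
  have [xl xlE] : exists xl : I -> 'Hom(K, L), forall i t, xl i t = x i t.
    by exists (fun i => linfun (x i)) => i t; rewrite lfunE.
  have [|q qE] := @hom_field_basis k K L I xl card_I _ f.
    move=> c c0; apply: embeddings_free => t; rewrite -[RHS](c0 t).
    by apply: eq_bigr => i _; rewrite xlE.
  by exists q => t; rewrite -fE qE; apply: eq_bigr => i _; rewrite xlE.
have /fin_all_exists[c cE] (iy : I * I) : exists c : 'Hom(S, L),
    forall h, c h = \sum_(j < \dim {:K}) x iy.1 (act h b`_j) * q j iy.2.
  apply: linear_lfun => a g h.
  rewrite scaler_sumr -big_split; apply: eq_bigr => j _ /=.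
  by rewrite linearP add_lfunE scale_lfunE linearP mulrDl scalerAl.
exists (fun i y => c (i, y)) => i h t.
rewrite [t in LHS](coord_vbasis (memvf t)) !linear_sum.
transitivity (\sum_(j < \dim {:K}) x i (act h b`_j) * (coord b j t)%:A).
  apply: eq_bigr => j _; rewrite !linearZ /= mulr_algr //.
under eq_bigr => j _ do rewrite qE mulr_sumr.
rewrite exchange_big; apply: eq_bigr => y _; rewrite cE mulr_suml.
by apply: eq_bigr => j _; rewrite mulrA.
Qed.

Variable c : I -> I -> 'Hom(S, L).
Hypothesis cE : forall i h t, x i (act h t) = \sum_j c i j h * x j t.

Lemma hopf_dim : \dim {:S} = #|I|.
Proof.
have [f fE] : exists f : 'Hom(tens K S, 'End(K)),
    forall t, f t = hopf_galois_map act t.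
  by apply: linear_lfun => a s t; exact: linearP.
have [g gK Kg] := hgs_bijective S.
have kerf : lker f == 0%VS.
  by apply/lker0P => s t; rewrite !fE => /(can_inj gK).
have /eqP imf : limg f == fullv.
  rewrite eqEsubv subvf /=; apply/subvP => h _.
  by rewrite -[h]Kg -fE memv_img ?memvf.
have := limg_dim_eq (f := f) (U := fullv); rewrite imf (eqP kerf) capv0.
move/(_ (erefl _)); rewrite dim_Hom dim_tens card_I => /eqP.
by rewrite eqn_pmul2l => [/eqP//|]; rewrite dimvf FalgType_proper.
Qed.

(** The Galois map is onto, so a relation between the entries of a row passes
    to the coefficients of every composite of x i with an endomorphism of K.
    The coordinate forms of K are such endomorphisms, and their coefficients
    make up the inverse of the matrix of the embeddings. *)
Lemma coefficients_free i (b : I -> L) :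
  (forall h, \sum_y b y * c i y h = 0) -> forall y, b y = 0.
Proof.
move=> b0.
pose e := vbasis {:K}.
have /fin_all_exists[q qE] (j : 'I_(\dim {:K})) : exists q : I -> L,
    \sum_y b y * q y = 0 /\
    forall t, (coord e j t)%:A = \sum_y q y * x y t.
  have [f fE] : exists f : 'End(K), forall t, f t = (coord e j t)%:A.
    by apply: linear_lfun => a u v; rewrite linearP /= scalerDl scalerA.
  have [g gK Kg] := hgs_bijective S.
  exists (fun y => tlift (fun s h => x i s * c i y h) (g f)); split.
    under eq_bigr => y _ do rewrite -tlift_mull.
    rewrite -tlift_sum -[RHS](tlift0 _ (g f)); apply: eq_tlift => s h.
    by under eq_bigr => y _ do rewrite mulrCA; rewrite -mulr_sumr b0 mulr0.
  move=> t; rewrite -(rmorph_alg (x i)) -fE -[in f t](Kg f) tlift_lfun.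
  rewrite linear_tlift; under eq_bigr => y _ do rewrite -tlift_mulr.
  rewrite -tlift_sum; apply: eq_tlift => s h.
  rewrite comp_lfunE [amull _ _]lfunE /= rmorphM /= cE mulr_sumr.
  by apply: eq_bigr => y _; rewrite mulrA.
move=> y0; transitivity (\sum_y b y * (y0 == y)%:R).
  rewrite (bigD1 y0) //= eqxx mulr1 big1 ?addr0 // => y.
  by rewrite eq_sym => /negPf->; rewrite mulr0.
have qdual y : \sum_(j < \dim {:K}) x y0 e`_j * q j y = (y0 == y)%:R.
  move: y; apply: embeddings_eq => t.
  rewrite [in RHS](bigD1 y0) //= eqxx mul1r [in RHS]big1 ?addr0 => [|y]; last first.
    by rewrite eq_sym => /negPf->; rewrite mul0r.
  rewrite [t in RHS](coord_vbasis (memvf t)) linear_sum.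
  under eq_bigr => y _ do rewrite mulr_suml.
  rewrite exchange_big; apply: eq_bigr => j _ /=; rewrite linearZ /=.
  have [_ /(_ t) qt] := qE j; rewrite -mulr_algr qt mulr_sumr.
  by apply: eq_bigr => y _; rewrite mulrA.
under eq_bigr => y _ do rewrite -qdual mulr_sumr.
rewrite exchange_big big1 //= => j _.
under eq_bigr => y _ do rewrite mulrCA.
by rewrite -mulr_sumr; have [-> _] := qE j; rewrite mulr0.
Qed.

Lemma coefficients_eq i (b d : I -> L) :
  (forall h, \sum_y b y * c i y h = \sum_y d y * c i y h) ->
  forall y, b y = d y.
Proof.
move=> bd y; apply/eqP; rewrite -subr_eq0; apply/eqP.
move: y; apply: (coefficients_free (i := i)) => h.
by under eq_bigr do rewrite mulrBl; rewrite sumrB bd subrr.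
Qed.

Lemma sum_delta (J : finType) (F : J -> L) j :
  \sum_i (j == i)%:R * F i = F j.
Proof.
rewrite (bigD1 j) //= eqxx mul1r big1 ?addr0 // => i.
by rewrite eq_sym => /negPf->; rewrite mul0r.
Qed.

Lemma coefficient_row_inj i y z : (forall h, c i y h = c i z h) -> y = z.
Proof.
move=> cyz; apply/eqP; move: z cyz.
suff H z : (forall h, c i y h = c i z h) -> (y == z)%:R = 1 :> L.
  by move=> z /H; case: eqP => // _ /esym/eqP; rewrite oner_eq0.
move=> cyz.
have := @coefficients_eq i (fun w => (y == w)%:R) (fun w => (z == w)%:R) _ z.
by rewrite eqxx => -> // h; rewrite !sum_delta.
Qed.

Lemma coefficient_neq0 i y a : (forall h, a * c i y h = 0) -> a = 0.
Proof.
move=> ac0; have := @coefficients_free i (fun w => a * (y == w)%:R) _ y.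
rewrite eqxx mulr1 => -> // h.
rewrite -[RHS](ac0 h) -(sum_delta (fun w => c i w h) y) mulr_sumr.
by apply: eq_bigr => w _; rewrite mulrA.
Qed.

(** The product of the algebra L (x) H^* dual to the coalgebra H. *)
Let conv (f g : 'Hom(S, L)) (h : S) : L :=
  tlift (fun u v => f u * g v) (comul S h).

(** Apply the embedding x i to h (s * t) in two ways: expanding h (s * t)
    itself, or the comultiplication of h. *)
Lemma coefficient_orthogonal i y z h :
  conv (c i y) (c i z) h = (y == z)%:R * c i y h.
Proof.
have [_ _ _ actM] := hgs_module_algebra S.
have cM s t : \sum_y (\sum_z conv (c i y) (c i z) h * x z t) * x y s =
              \sum_y (\sum_z (y == z)%:R * c i y h * x z t) * x y s.
  transitivity (x i (act h (s * t))).
    rewrite actM linear_tlift.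
    under eq_bigr => y' _ do [under eq_bigr => z' _ do
      rewrite -tlift_mulr; rewrite -tlift_sum -tlift_mulr].
    rewrite -tlift_sum; apply: eq_tlift => u v.
    rewrite rmorphM /= !cE mulr_suml; apply: eq_bigr => y' _.
    rewrite mulr_sumr mulr_suml; apply: eq_bigr => z' _; ring.
  rewrite cE; apply: eq_bigr => y' _; rewrite rmorphM /=.
  under eq_bigr => z' _ do rewrite -mulrA.
  by rewrite sum_delta; ring.
move: z; apply: embeddings_eq => t.
by move: y; apply: embeddings_eq => s.
Qed.

Lemma coefficient_expand i (f : 'Hom(S, L)) :
  exists b : I -> L, forall h, f h = \sum_y b y * c i y h.
Proof. by apply: hom_field_basis; [rewrite hopf_dim | exact: coefficients_free]. Qed.

(** Every row is a basis of L (x) H^* made of orthogonal idempotents, hence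
    consists of all the primitive idempotents of this algebra: the rows are
    permutations of one another. *)
Lemma coefficient_transfer i y i' :
  exists y', forall h, c i y h = c i' y' h.
Proof.
have [a aE] := coefficient_expand i' (c i y).
have [y' ay'] : exists y', a y' != 0.
  apply/existsP; apply: contraT => /existsPn a0.
  suff /eqP : 1 = 0 :> L by rewrite oner_eq0.
  apply: (@coefficient_neq0 i y) => h; rewrite mul1r aE big1 // => z _.
  by have /negPn/eqP-> := a0 z; rewrite mul0r.
have [b bE] := coefficient_expand i (c i' y').
have ab h : a y' * c i' y' h = b y * c i y h.
  transitivity (conv (c i y) (c i' y') h).
    rewrite /conv; under eq_tlift => u v do rewrite aE mulr_suml.
    rewrite tlift_sum -[LHS](sum_delta (fun z => a z * c i' z h)).
    apply: eq_bigr => z _; under eq_tlift => u v do rewrite -mulrA.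
    rewrite tlift_mull -/(conv _ _ _) coefficient_orthogonal eq_sym; ring.
  rewrite /conv; under eq_tlift => u v do rewrite bE mulr_sumr.
  rewrite tlift_sum -[RHS](sum_delta (fun z => b z * c i z h)).
  apply: eq_bigr => z _; under eq_tlift => u v do rewrite mulrCA.
  rewrite tlift_mull -/(conv _ _ _) coefficient_orthogonal.
  by case: eqP => [->|_]; rewrite ?mul0r ?mulr0 //; ring.
exists y'.
pose l := b y / a y'.
have cl h : c i' y' h = l * c i y h.
  by apply: (mulfI ay'); rewrite ab /l; field.
have ll : l * (l - 1) = 0.
  apply: (@coefficient_neq0 i y) => h.
  have := coefficient_orthogonal i' y' y' h; rewrite eqxx mul1r cl.
  rewrite /conv; under eq_tlift => u v do rewrite !cl mulrACA.
  rewrite tlift_mull -/(conv _ _ _) coefficient_orthogonal eqxx mul1r.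
  by move/eqP; rewrite -subr_eq0 => /eqP <-; ring.
move/eqP: ll; rewrite mulf_eq0 subr_eq0 => /orP[] /eqP l01 h; last first.
  by rewrite cl l01 mul1r.
suff /eqP : 1 = 0 :> L by rewrite oner_eq0.
by apply: (@coefficient_neq0 i' y') => h'; rewrite cl l01 mul0r mulr0.
Qed.

(** The unit of H takes the value 1 on the diagonal and 0 off it. *)
Lemma coefficient_unit i y z :
  (forall h, c i i h = c y z h) -> y = z.
Proof.
have [act1 _ _ _] := hgs_module_algebra S.
have c1 w w' : c w w' 1 = (w == w')%:R.
  move: w'; apply: embeddings_eq => t.
  by rewrite -cE sum_delta act1 id_lfunE.
move=> /(_ 1); rewrite !c1 eqxx; case: eqP => // _ /eqP.
by rewrite oner_eq0.
Qed.

(** Closure of N under composition: the product of H makes the table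
    multiply like a matrix, and the first factors, being linearly independent,
    can be cancelled. *)
Lemma coefficient_comp i y z i' y' z' :
    (forall h, c i y h = c i' y' h) -> (forall h, c y z h = c y' z' h) ->
  forall h, c i z h = c i' z' h.
Proof.
have [_ actM _ _] := hgs_module_algebra S.
have cM w w' g h : c w w' (g * h) = \sum_u c w u g * c u w' h.
  move: w'; apply: embeddings_eq => t.
  rewrite -cE actM comp_lfunE cE.
  under eq_bigr => u _ do rewrite cE mulr_sumr.
  rewrite exchange_big; apply: eq_bigr => u _ /=.
  by rewrite mulr_suml; apply: eq_bigr => v _; rewrite mulrA.
move=> ciy cyz.
have [z'' ciz] := coefficient_transfer i z i'.
suff <- : z'' = z' by [].
have /fin_all_exists[p pE] w := coefficient_transfer i' w i.
have p_inj : injective p.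
  by move=> w w' ppw; apply: (@coefficient_row_inj i') => h; rewrite !pE ppw.
apply: (@coefficient_row_inj y') => h; rewrite -cyz.
have py : p y' = y by apply: (@coefficient_row_inj i) => g; rewrite -pE -ciy.
rewrite -py; transitivity (c (invF p_inj (p y')) z'' h); first by rewrite invF_f.
apply/esym; move: (p y'); apply: (@coefficients_eq i) => g.
transitivity (c i z (g * h)); first by rewrite cM; apply: eq_bigr => u _; rewrite mulrC.
rewrite ciz cM [RHS](reindex_inj p_inj); apply: eq_bigr => w _.
by rewrite invF_f pE mulrC.
Qed.

(** As the comultiplication maps A to A (x) A, the elements of A act linearly
    over the fixed field of A, so only the embeddings that agree with x i there
    occur in the expansion of x i after h. *)
Lemma coefficient_support (A : {vspace S}) i y h t :
    sub_hopf_algebra A -> h \in A -> t \in hopf_fixed A -> c i y h != 0 ->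
  x i t = x y t.
Proof.
move=> [_ _ /subvP comulA _] hA /hopf_fixedP tA ciy.
have [_ _ _ actM] := hgs_module_algebra S.
have h_lin s : act h (t * s) = t * act h s.
  have [f fE] : exists f : 'Hom(tens S S, K),
      forall u, f u = tlift (fun a b => act a t * act b s) u.
    by apply: linear_lfun; exact: linearP.
  have [g gE] : exists g : 'Hom(tens S S, K),
      forall u, g u = tlift (fun a b => ((counit S a : k) *: t) * act b s) u.
    by apply: linear_lfun; exact: linearP.
  have bil (l : 'Hom(S, K)) : bilinear_fun (fun a b => l a * act b s).
    split=> [a|b] e u v; first by rewrite linearP add_lfunE scale_lfunE mulrDr scalerAr.
    by rewrite linearP mulrDl scalerAl.
  have [l lE] : exists l : 'Hom(S, K), forall a, l a = act a t.
    by apply: linear_lfun => e u v; rewrite linearP add_lfunE scale_lfunE.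
  have [m mE] : exists m : 'Hom(S, K), forall a, m a = (counit S a : k) *: t.
    by apply: linear_lfun => e u v; rewrite linearP /= scalerDl scalerA.
  have fg : (tens_sub A A <= lker (f - g))%VS.
    apply/span_subvP => _ /allpairsP[[a b] /= [aA bA ->]].
    rewrite memv_ker add_lfunE opp_lfunE subr_eq0 fE gE.
    have -> : tlift (fun a b => act a t * act b s) (tmul a b) = l a * act b s.
      by rewrite -(tlift_tmul (bil l)); apply: eq_tlift => ? ?; rewrite lE.
    have -> : tlift (fun a b => ((counit S a : k) *: t) * act b s) (tmul a b)
        = m a * act b s.
      by rewrite -(tlift_tmul (bil m)); apply: eq_tlift => ? ?; rewrite mE.
    by rewrite lE mE tA // vbasis_mem.
  have /(subvP fg) : comul S h \in tens_sub A A by apply/comulA/memv_img.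
  rewrite memv_ker add_lfunE opp_lfunE subr_eq0 fE gE -actM => /eqP->.
  rewrite -[in RHS](counitl h) linear_tlift tlift_lfun -tlift_mull.
  by apply: eq_tlift => a b; rewrite linearZ scale_lfunE -scalerAl scalerAr.
have : c i y h * (x y t - x i t) = 0.
  move: y {ciy}; apply: embeddings_free => s.
  transitivity (x i (act h (t * s)) - x i t * x i (act h s)).
    rewrite !cE mulr_sumr -sumrB; apply: eq_bigr => y _.
    by rewrite rmorphM /=; ring.
  by rewrite h_lin rmorphM subrr.
by move/eqP; rewrite mulf_eq0 (negPf ciy) subr_eq0 => /eqP.
Qed.

(** If all the entries off the diagonal vanish on A, then A acts through
    scalars, that is through the counit, and fixes K. *)
Lemma coefficient_nontrivial (A : {vspace S}) i :
    hopf_fixed A != fullv ->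
  exists h y, [/\ h \in A, y != i & c i y h != 0].
Proof.
move=> A_neq.
have [_ _ act_1 _] := hgs_module_algebra S.
have : ~~ all (fun h => [forall y, (y != i) ==> (c i y h == 0)]) (vbasis A).
  apply: contra A_neq => /allP c0; rewrite eqEsubv subvf; apply/subvP => s _.
  apply/hopf_fixedP => h hA.
  have ch y : y != i -> c i y h = 0.
    move=> yi; rewrite (coord_vbasis hA) linear_sum big1 // => j _.
    have /c0/forallP/(_ y) : (vbasis A)`_j \in vbasis A by rewrite mem_nth ?size_tuple.
    by rewrite yi linearZ => /eqP /= ->; rewrite scaler0.
  have chE t : x i (act h t) = c i i h * x i t.
    by rewrite cE (bigD1 i) //= big1 ?addr0 // => y /ch->; rewrite mul0r.
  apply: (fmorph_inj (x i)); rewrite /= chE.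
  have := chE 1; rewrite act_1 rmorph1 mulr1 => <-.
  by rewrite -rmorphM mulr_algl.
case/allPn => h hA /forallPn[y]; rewrite negb_imply => /andP[yi ch].
by exists h, y; split=> //; apply: vbasis_mem.
Qed.

End CoefficientTable.

(** * Pure extensions *)

(** E(v) with v ^+ n = theta.  The coordinates on the powers of v are linear
    over the ground field k, so that a tower stays within extensions of k. *)
Record pureExt (k : fieldType) (E : fieldExtType k) (n : nat) (theta : E) := PureExt {
  pure_field :> fieldExtType k;
  pure_in : {lrmorphism E -> pure_field};
  pure_root : pure_field;
  pure_rootX : pure_root ^+ n = pure_in theta;
  pure_coord : 'I_n -> 'Hom(pure_field, E);
  pure_coordE : forall x, x = \sum_i pure_in (pure_coord i x) * pure_root ^+ i;
  pure_coordK : forall (i j : 'I_n) a,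
    pure_coord i (pure_in a * pure_root ^+ j) = (i == j)%:R * a;
  pure_dim : \dim {:pure_field} = (n * \dim {:E})%N
}.

Lemma pureExt_exists (k : fieldType) (E : fieldExtType k) (n : nat) (theta : E) :
  (0 < n)%N -> irreducible_poly ('X^n - theta%:P) -> inhabited (pureExt n theta).
Proof.
move=> n_gt0 /irredp_FAdjoin[L dimL [z rz Lz]].
rewrite size_XnsubC //= in dimL.
have zX : z ^+ n = theta%:A.
  move: rz; rewrite /root rmorphB /= map_polyXn map_polyC /=.
  by rewrite !hornerE subr_eq0 => /eqP.
pose X := [tuple z ^+ i | i < n].
have XE (i : 'I_n) : X`_i = z ^+ i by rewrite -tnth_nth tnth_mktuple.
have degz : adjoin_degree 1 z = n.
  by apply/esym; rewrite -dimL -Lz dim_Fadjoin dimv1 muln1.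
have Xspan : (fullv <= <<X>>)%VS.
  apply/subvP => x _.
  have /Fadjoin_poly_eq <- : x \in <<1; z>>%VS by rewrite Lz memvf.
  have := size_Fadjoin_poly 1 z x; rewrite degz => /horner_coef_wide ->.
  apply: memv_suml => i _.
  have /polyOverP/(_ i)/vlineP[a ->] := Fadjoin_polyOver 1 z x.
  rewrite mulr_algl memvZ // -(XE i) memv_span // mem_nth //.
  by rewrite size_tuple.
have Xbasis : basis_of fullv X.
  by rewrite basisEdim Xspan size_tuple dimL leqnn.
pose L0 : fieldExtType k := baseFieldType L.
have scaleE (a : k) (x : L) : a *: (x : L0) = (a%:A : E) *: x by [].
have in_lin : linear (in_alg L : E -> L0).
  by move=> a x y; rewrite scaleE /= scalerDl scalerA mulr_algl.
have in_rm : monoid_morphism (in_alg L : E -> L0).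
  by split; [exact: (rmorph1 (in_alg L)) | exact: (rmorphM (in_alg L))].
pose inL := GRing.isLinear.Build k E L0 _ (in_alg L) in_lin.
pose inM := GRing.isMonoidMorphism.Build E L0 (in_alg L) in_rm.
pose inLR : {lrmorphism E -> L0} := HB.pack (in_alg L : E -> L0) inL inM.
have /fin_all_exists[co coE] (i : 'I_n) :
    exists c : 'Hom(L0, E), forall x, c x = coord X i x.
  apply: (@linear_lfun k L0 E (coord X i)) => a x y.
  by rewrite scaleE linearP /= mulr_algl.
constructor; apply: (@PureExt k E n theta L0 inLR z _ co) => //.
- move=> x; rewrite [LHS](coord_basis Xbasis (memvf (x : L))).
  by apply: eq_bigr => i _; rewrite coE XE; exact: esym (@mulr_algl E L _ _).
- move=> i j a; rewrite coE -[_ * _]/(a%:A * z ^+ j) mulr_algl linearZ /=.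
  by rewrite -XE coord_free ?(basis_free Xbasis) // mulrC eq_sym.
have -> : fullv = baseVspace {:L} :> {vspace L0}.
  apply/vspaceP => x; rewrite memvf; apply/esym; rewrite mem_baseVspace.
  exact: memvf.
by rewrite dim_baseVspace dimL.
Qed.

Section PureExtension.

Variables (k : fieldType) (E : fieldExtType k) (n : nat) (theta : E).
Variables (K : pureExt n theta).
Hypothesis n_gt0 : (0 < n)%N.

Local Notation iota := (pure_in K).
Local Notation v := (pure_root K).
Local Notation co := (@pure_coord k E n theta K).

Lemma pure_coord_in a i : co i (iota a) = (i == 0 :> nat)%:R * a.
Proof. by rewrite -[iota a]mulr1 (pure_coordK K i (Ordinal n_gt0)). Qed.

Lemma pure_coordZ i a x : co i (iota a * x) = a * co i x.
Proof.
rewrite [x in LHS]pure_coordE [x in RHS]pure_coordE mulr_sumr !linear_sum mulr_sumr.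
by apply: eq_bigr => j _; rewrite mulrA -rmorphM /= !pure_coordK mulrCA.
Qed.

Lemma pure_in_inj : injective iota.
Proof. exact: fmorph_inj. Qed.

Lemma pure_root_neq0 : theta != 0 -> v != 0.
Proof.
apply: contraNneq => v0; apply/eqP/pure_in_inj.
rewrite -pure_rootX v0 expr0n rmorph0; by move: n_gt0; rewrite lt0n => /negPf->.
Qed.

Lemma pure_hom_eq (F : fieldExtType k) (f g : {lrmorphism K -> F}) :
  (forall a, f (iota a) = g (iota a)) -> f v = g v -> f =1 g.
Proof.
move=> fg fgv x; rewrite [x]pure_coordE !rmorph_sum; apply: eq_bigr => i _.
by rewrite !rmorphM !rmorphXn /= fg fgv.
Qed.

(** Universal property of E(v).  The formula for the lift of a monomial
    iota a * v ^+ m holds for every m, and products of monomials are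
    monomials. *)
Lemma pure_lift (F : fieldExtType k) (phi : {lrmorphism E -> F}) (w : F) :
    w ^+ n = phi theta ->
  exists psi : {lrmorphism K -> F},
    (forall a, psi (iota a) = phi a) /\ psi v = w.
Proof.
move=> wX; pose f x := \sum_(i < n) phi (co i x) * w ^+ i.
have f_lin : linear f.
  move=> a x y; rewrite scaler_sumr -big_split; apply: eq_bigr => i _ /=.
  by rewrite !linearP /= mulrDl scalerAl.
pose fL := GRing.isLinear.Build k K F _ f f_lin.
pose fl : {linear K -> F} := HB.pack f fL.
have f_mon a m : f (iota a * v ^+ m) = phi a * w ^+ m.
  have q_lt : (m %% n < n)%N by rewrite ltn_mod.
  have XE (R : comNzRingType) (t : R) : t ^+ m = (t ^+ n) ^+ (m %/ n) * t ^+ (m %% n).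
    by rewrite {1}(divn_eq m n) exprD mulnC exprM.
  rewrite XE pure_rootX -rmorphXn mulrA -rmorphM /f.
  rewrite (bigD1 (Ordinal q_lt)) //= (pure_coordK K _ (Ordinal q_lt)) eqxx mul1r.
  rewrite big1 ?addr0 => [|i iq]; last first.
    by rewrite (pure_coordK K _ (Ordinal q_lt)) (negPf iq) mul0r rmorph0 mul0r.
  by rewrite rmorphM rmorphXn /= -wX -mulrA -XE.
have f1 : f 1 = 1.
  by have := f_mon 1 0%N; rewrite expr0 !rmorph1 !mulr1.
have fM : monoid_morphism f.
  split=> // x y; rewrite [x in LHS]pure_coordE [y in LHS]pure_coordE.
  rewrite mulr_suml [LHS](linear_sum fl) [f x in RHS]/f mulr_suml.
  apply: eq_bigr => i _; rewrite mulr_sumr [LHS](linear_sum fl) mulr_sumr.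
  apply: eq_bigr => j _; rewrite mulrACA -rmorphM -exprD [LHS]f_mon.
  by rewrite rmorphM exprD mulrACA.
pose fMM := GRing.isMonoidMorphism.Build K F f fM.
pose psi : {lrmorphism K -> F} := HB.pack f fL fMM.
exists psi; split=> [a|].
  by have := f_mon a 0%N; rewrite !expr0 !mulr1.
by have := f_mon 1 1%N; rewrite !rmorph1 !expr1 !mul1r.
Qed.

End PureExtension.

(** * Cubes in a biquadratic field *)

Lemma eisenstein_no_root (p : nat) (q : {poly int}) :
    prime p -> (2 < size q)%N -> ~~ (p %| lead_coef q)%Z ->
    ~~ (p ^+ 2 %| q`_0)%Z -> (forall i, (i < (size q).-1)%N -> p %| q`_i)%Z ->
  forall x : rat, (map_poly intr q).[x] != 0.
Proof.
move=> p_pr q_gt2 ql q0 qi x.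
have /irreducible_rat_int[_ irr] : irreducible_poly q.
  by apply: (eisenstein_crit p_pr) => //; case: (size q) q_gt2 => [|[|]].
apply/negP => qx.
have := irr ('X - x%:P); rewrite size_XsubC dvdp_XsubCl /root => /(_ isT qx).
move/eqp_size; rewrite size_XsubC size_rat_int_poly => q2.
by rewrite -q2 in q_gt2.
Qed.

Lemma horner_Poly_intr (s : seq int) (x : rat) :
  (map_poly intr (Poly s)).[x] = foldr (fun a y => y * x + a%:~R) 0 s.
Proof.
elim: s => [|a s IHs] /=; first by rewrite rmorph0 horner0.
by rewrite cons_poly_def rmorphD rmorphM /= map_polyX map_polyC !hornerE IHs.
Qed.

Lemma eisenstein_seq (p : nat) (s : seq int) :
    prime p -> (2 < size s)%N -> ~~ (p %| last 1 s)%Z ->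
    ~~ (p ^+ 2 %| s`_0)%Z -> all (fun i => p %| s`_i)%Z (iota 0 (size s).-1) ->
  forall x : rat, foldr (fun a y => y * x + a%:~R) 0 s != 0.
Proof.
move=> p_pr s_gt2 sl s0 /allP si x; rewrite -horner_Poly_intr.
have sE : Poly s = s :> seq int.
  by rewrite (PolyK (c := 1)) //; apply: contraNneq sl => ->.
have lE : lead_coef (Poly s) = last 1 s.
  by rewrite lead_coefE sE; case: (s) s_gt2 => // a s' _; rewrite nth_last.
apply: (eisenstein_no_root p_pr); rewrite ?lE ?coef_Poly ?sE //.
by move=> i i_lt; apply: si; rewrite mem_iota.
Qed.

Lemma rat_sqr_neq3 (x : rat) : x ^+ 2 != 3.
Proof.
apply/eqP => x2; have /eqP[] := @eisenstein_seq 3 [:: -3; 0; 1] isT isT isT isT isT x.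
transitivity (x ^+ 2 - 3); first by rewrite /=; ring.
by rewrite x2; ring.
Qed.

Lemma rat_cube_neqN2 (x : rat) : x ^+ 3 != -2.
Proof.
apply/eqP => x2; have /eqP[] := @eisenstein_seq 2 [:: 2; 0; 0; 1] isT isT isT isT isT x.
transitivity (x ^+ 3 + 2); first by rewrite /=; ring.
by rewrite x2; ring.
Qed.

Lemma rat_cubic_no_root (x : rat) : x ^+ 3 - 3 * x ^+ 2 + 9 * x - 3 != 0.
Proof.
apply/eqP => x2.
have /eqP[] := @eisenstein_seq 3 [:: -3; 9; -3; 1] isT isT isT isT isT x.
by rewrite -[RHS]x2 /=; ring.
Qed.

Lemma rat_sum_sqr_neqN3 (p q : rat) : p * p + 3 * q * q <> - 3.
Proof. by nra. Qed.

(** The two equations are the coordinates of (p + q sqrt 3)^3 = -2 - 2 sqrt 3,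
    and p / q is then a root of the cubic above. *)
Lemma rat_cubic_system (p q : rat) :
  - 2 = 3 * p * p * q + 3 * q * q * q -> - 2 = p * p * p + 9 * p * q * q -> False.
Proof.
move=> e1 e0; have q0 : q != 0.
  by apply/eqP => q0; move: e1; rewrite q0 => ?; lra.
have /eqP[] := rat_cubic_no_root (p / q).
have h : (p * p * p + 9 * p * q * q) - (3 * p * p * q + 3 * q * q * q) = 0.
  by rewrite -e1 -e0 subrr.
by apply: (mulIf (expf_neq0 3 q0)); rewrite mul0r -h; field.
Qed.

Lemma XnsubC_irreducible (F : fieldType) (n : nat) (a : F) :
    (1 < n <= 3)%N -> (forall x, x ^+ n != a) -> irreducible_poly ('X^n - a%:P).
Proof.
move=> /andP[n_gt1 n_le3] no_root; apply: cubic_irreducible.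
  by rewrite size_XnsubC ?ltnS ?n_le3 ?(ltnW n_gt1) // ltnW.
by move=> x; rewrite /root !hornerE subr_eq0.
Qed.

Section QuadraticExtension.

Variables (k : fieldType) (E : fieldExtType k) (d : E) (F : pureExt 2 d).

Local Notation iota := (pure_in F).
Local Notation v := (pure_root F).

Lemma quad_expand b :
  b = iota (pure_coord F ord0 b) + iota (pure_coord F ord_max b) * v.
Proof.
rewrite [LHS]pure_coordE big_ord_recl big_ord1 expr0 mulr1 expr1.
by congr (_ + iota (pure_coord F _ b) * _); apply: val_inj.
Qed.

Lemma quad_coord0 x y : pure_coord F ord0 (iota x + iota y * v) = x.
Proof.
rewrite linearD /= pure_coord_in //= mul1r.
by rewrite -[v]expr1 (pure_coordK F _ ord_max) mul0r addr0.
Qed.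

Lemma quad_coord1 x y : pure_coord F ord_max (iota x + iota y * v) = y.
Proof.
rewrite linearD /= pure_coord_in //= mul0r add0r.
by rewrite -[v]expr1 (pure_coordK F _ ord_max) mul1r.
Qed.

Lemma quad_conj : exists conj : {lrmorphism F -> F},
  (forall a, conj (iota a) = iota a) /\ conj v = - v.
Proof. by apply: pure_lift => //; rewrite sqrrN pure_rootX. Qed.

Lemma quad_norm (conj : {lrmorphism F -> F}) b :
    (forall a, conj (iota a) = iota a) -> conj v = - v ->
  exists c, iota c = b * conj b.
Proof.
move=> conj_in conj_v; have v2 : v * v = iota d by rewrite -expr2 pure_rootX.
move: (pure_coord F ord0 b) (pure_coord F ord_max b) (quad_expand b) => x y ->.
exists (x ^+ 2 - d * y ^+ 2).
rewrite (rmorphD conj) (rmorphM conj) !rmorphB !rmorphXn rmorphM rmorphXn /=.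
by rewrite !conj_in conj_v -v2; ring.
Qed.

(** The norm c of b satisfies c^3 = a^2, whence a = (a / c)^3. *)
Lemma cube_descends a b : a != 0 -> b ^+ 3 = iota a -> exists c, c ^+ 3 = a.
Proof.
move=> a0 b3; have [conj [conj_in conj_v]] := quad_conj.
have [c cE] := quad_norm b conj_in conj_v.
have c3 : c ^+ 3 = a ^+ 2.
  apply: (fmorph_inj iota); rewrite !rmorphXn /= cE exprMn -rmorphXn b3.
  by rewrite /= conj_in.
by exists (a / c); rewrite expr_div_n c3; field.
Qed.

End QuadraticExtension.

(** A field E = k(theta, omega) of degree 4, with omega a primitive cube root of
    unity.  In bq_gal t r the bit t tells whether theta is moved to its
    conjugate, and r whether omega is inverted.  By Kummer theory, the last
    three conditions make the cube roots of theta and of its conjugate generate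
    independent cubic extensions of E. *)
Record biquadratic (k : fieldType) := Biquadratic {
  bq_field :> fieldExtType k;
  bq_dim : \dim {:bq_field} = 4;
  bq_gal : bool -> bool -> {lrmorphism bq_field -> bq_field};
  bq_galM : forall t r t' r' a,
    bq_gal t r (bq_gal t' r' a) = bq_gal (t (+) t') (r (+) r') a;
  bq_omega : bq_field;
  bq_omegaE : bq_omega ^+ 2 + bq_omega + 1 = 0;
  bq_omega_neq1 : bq_omega != 1;
  bq_gal_omega : forall t r,
    bq_gal t r bq_omega = if r then bq_omega ^+ 2 else bq_omega;
  bq_theta : bool -> bq_field;
  bq_gal_theta : forall t r b, bq_gal t r (bq_theta b) = bq_theta (t (+) b);
  bq_norm : k;
  bq_normE : bq_theta false * bq_theta true = bq_norm%:A :> bq_field;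
  bq_theta_ncube : forall x, x ^+ 3 != bq_theta false;
  bq_norm_ncube : forall x, x ^+ 3 != bq_norm%:A :> bq_field;
  bq_norm_theta_ncube : forall x, x ^+ 3 != bq_norm%:A * bq_theta false :> bq_field
}.

(** The field is Q(sqrt 3, sqrt -3), with theta = 1 + sqrt 3, whose product
    with its conjugate is -2.  The elements that must not be cubes lie in
    Q(sqrt 3), to which cubes descend; there the norm to Q would make -2 a cube,
    except for -2 theta, where coordinates are compared. *)
Lemma biquadratic_exists : inhabited (biquadratic rat).
Proof.
have [F1] : inhabited (pureExt (E := rat^o) 2 3).
  apply: pureExt_exists => //; apply: XnsubC_irreducible => // x.
  exact: rat_sqr_neq3.
set r3 := pure_root F1.
have r3E : r3 ^+ 2 = 3 by rewrite pure_rootX rmorph_nat.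
pose i1 := pure_in F1.
have [F2] : inhabited (pureExt (E := F1) 2 (- 3)).
  apply: pureExt_exists => //; apply: XnsubC_irreducible => // b.
  apply/negP => /eqP b2.
  have := congr1 (pure_coord F1 ord0) b2.
  rewrite [b]quad_expand.
  set x := pure_coord F1 ord0 b; set y := pure_coord F1 ord_max b.
  have -> : (pure_in F1 x + pure_in F1 y * pure_root F1) ^+ 2 =
     pure_in F1 (x * x + 3 * y * y) + pure_in F1 (2 * x * y) * pure_root F1.
    rewrite !rmorphD !rmorphM !rmorph_nat /= -r3E -/r3; ring.
  have -> : (- 3 : F1) = pure_in F1 (- 3) + pure_in F1 0 * pure_root F1.
    by rewrite rmorphN rmorph_nat rmorph0 mul0r addr0.

  by rewrite !quad_coord0 => /rat_sum_sqr_neqN3.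
set w := pure_root F2; pose i2 := pure_in F2.
have wE : w ^+ 2 = - 3 by rewrite pure_rootX rmorphN rmorph_nat.
have /fin_all_exists[conj conjE] (t : bool) : exists f : {lrmorphism F1 -> F1},
    (forall a, f (i1 a) = i1 a) /\ f r3 = (-1) ^+ t * r3.
  by apply: pure_lift => //; rewrite exprMn sqrr_sign mul1r pure_rootX.
have /fin_all_exists[g gE] (tr : bool * bool) : exists f : {lrmorphism F2 -> F2},
    (forall a, f (i2 a) = i2 (conj tr.1 a)) /\ f w = (-1) ^+ tr.2 * w.
  have [|f [fi fw]] := @pure_lift _ _ _ _ F2 isT F2 (i2 \o conj tr.1)
    ((-1) ^+ tr.2 * w).
    by rewrite exprMn sqrr_sign mul1r pure_rootX /= !rmorphN !rmorph_nat.
  by exists f.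
have g_in t r a : g (t, r) (i2 a) = i2 (conj t a) by have [->] := gE (t, r).
have g_w t r : g (t, r) w = (-1) ^+ r * w by have [_ ->] := gE (t, r).
have conj_in t a : conj t (i1 a) = i1 a by have [->] := conjE t.
have conj_r3 t : conj t r3 = (-1) ^+ t * r3 by have [_ ->] := conjE t.
have conjM t t' a : conj t (conj t' a) = conj (t (+) t') a.
  rewrite [a]quad_expand -/i1 !rmorphD !rmorphM /= !conj_in -/r3 !conj_r3.
  rewrite rmorphM rmorph_sign /= conj_r3 signr_addb.
  by rewrite (mulrCA ((-1) ^+ t')) !mulrA.
have two0 : (2 : F2) != 0 by rewrite -(rmorph_nat (in_alg F2)) fmorph_eq0.
have four0 : (4 : F2) != 0 by rewrite -(rmorph_nat (in_alg F2)) fmorph_eq0.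

pose om : F2 := (-1 + w) / 2.
have omw : w = 2 * om + 1 by rewrite /om; field.
have omE : om ^+ 2 + om + 1 = 0.
  have : w ^+ 2 + 3 = 0 by rewrite wE; ring.
  rewrite omw => h; have : 4 * (om ^+ 2 + om + 1) = 0 by rewrite -h; ring.
  by move/eqP; rewrite mulf_eq0 (negPf four0) => /eqP.
pose th b : F2 := i2 (1 + (-1) ^+ b * r3).
have norm3 (c : F1) : exists y : rat, i1 y = c * conj true c.
  have [|y yE] := @quad_norm _ _ _ F1 (conj true) c (conj_in true); last by exists y.
  by rewrite conj_r3 expr1 mulN1r.
have N2_cube (c : F1) : c ^+ 3 != -2.
  apply/negP => /eqP c3.
  have [||y y3] := @cube_descends _ rat^o 3 F1 (- 2) c.
  - by rewrite oppr_eq0.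
  - by rewrite c3 rmorphN rmorph_nat.
  by have /eqP := rat_cube_neqN2 y.
have th_cube (c : F1) : c ^+ 3 != 1 + r3.
  apply/negP => /eqP c3; have [y yE] := norm3 c.
  have /eqP[] := rat_cube_neqN2 y; apply: (fmorph_inj i1).
  rewrite rmorphXn /= yE exprMn -rmorphXn c3 rmorphD rmorph1 /= conj_r3.
  rewrite expr1 rmorphN rmorph_nat; transitivity (1 - r3 ^+ 2); first by ring.
  by rewrite r3E; ring.
have nth_cube (c : F1) : c ^+ 3 != - 2 * (1 + r3).
  apply/negP => /eqP c3.
  have c3' : i1 (- 2) + i1 (- 2) * r3 = c ^+ 3.
    by rewrite c3 rmorphN rmorph_nat /=; ring.
  move: (pure_coord F1 ord0 c) (pure_coord F1 ord_max c) (quad_expand c) c3'.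
  rewrite -/i1 -/r3 => x y -> c3'.
  have xy3 : (i1 x + i1 y * r3) ^+ 3 = i1 (x * x * x + 9 * x * y * y) +
      i1 (3 * x * x * y + 3 * y * y * y) * r3.
    by rewrite !rmorphD !rmorphM !rmorph_nat /=; ring: r3E.
  have := congr1 (pure_coord F1 ord0) c3'; have := congr1 (pure_coord F1 ord_max) c3'.
  rewrite xy3 !quad_coord0 !quad_coord1 => e1 e0.
  exact: rat_cubic_system e1 e0.
have th_neq0 : 1 + r3 != 0.
  by apply: contraNneq (th_cube 0) => ->; rewrite expr0n.
have th0 : th false = i2 (1 + r3) by rewrite /th expr0 mul1r.
apply: inhabits.
apply: (@Biquadratic rat F2 _ (fun t r => g (t, r)) _ om omE _ _ th _ (-2)).
- by rewrite pure_dim pure_dim dimvf.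
- move=> t r t' r' a; rewrite [a]quad_expand -/i2 -/w.
  rewrite !rmorphD !rmorphM /= !g_in !g_w !conjM.
  rewrite rmorphM rmorph_sign /= g_w signr_addb.
  by rewrite (mulrCA ((-1) ^+ r')) !mulrA.
- apply/eqP => om1; move: omE; rewrite om1 => h.
  have : (3 : F2) != 0 by rewrite -(rmorph_nat (in_alg F2)) fmorph_eq0.
  by apply/negP; rewrite negbK -h; apply/eqP; ring.
- move=> t r; have g2 : g (t, r) 2 = 2 by rewrite rmorph_nat.
  apply: (mulIf two0); case: r g2 => g2.
    rewrite -g2 -rmorphM /om divfK // rmorphD rmorphN rmorph1 /= g_w g2.
    rewrite -/om omw expr1; have : om ^+ 2 = - om - 1.
      by apply/eqP; rewrite -subr_eq0 -omE; apply/eqP; ring.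
    by move=> ->; ring.
  rewrite -g2 -rmorphM /om divfK // rmorphD rmorphN rmorph1 /= g_w expr0 mul1r.
  by rewrite g2 divfK.
- move=> t r b; rewrite /th g_in rmorphD rmorph1 rmorphM rmorph_sign /= conj_r3.
  by rewrite mulrA -signr_addb addbC.
- rewrite /th -rmorphM expr0 expr1; transitivity (i2 (-2)).
    by congr (i2 _); transitivity (1 - r3 ^+ 2); [ring | rewrite r3E; ring].
  by rewrite scaleNr rmorphN rmorph_nat scaler_nat.
- move=> x; rewrite th0; apply/negP => /eqP x3.
  have [y y3] := cube_descends th_neq0 x3.
  by have /eqP := th_cube y.
- move=> x; apply/negP => /eqP x3.
  have [||y y3] := @cube_descends _ _ _ F2 (- 2) x.
  - by rewrite oppr_eq0 -(rmorph_nat (in_alg F1)) fmorph_eq0.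
  - by rewrite x3 scaleNr rmorphN rmorph_nat scaler_nat.
  by have /eqP := N2_cube y.
move=> x; rewrite th0; apply/negP => /eqP x3.
have [||y y3] := @cube_descends _ _ _ F2 (- 2 * (1 + r3)) x.
- rewrite mulf_neq0 // oppr_eq0 -(rmorph_nat (in_alg F1)) fmorph_eq0 //.
- by rewrite x3 scaleNr rmorphM rmorphN rmorph_nat scaler_nat.
by have /eqP := nth_cube y.
Qed.

(** * Kummer theory over a biquadratic field *)

Lemma cube_eq (F : fieldType) (w x y : F) : w ^+ 2 + w + 1 = 0 ->
  x ^+ 3 = y ^+ 3 -> exists j : 'I_3, x = w ^+ j * y.
Proof.
move=> w0 xy; have : (x - y) * ((x - w * y) * (x - w ^+ 2 * y)) = 0.
  have w2 : w ^+ 2 = - w - 1.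
    by apply/eqP; rewrite -subr_eq0 -w0; apply/eqP; ring.
  transitivity (x ^+ 3 - y ^+ 3); last by rewrite xy subrr.
  by ring: w2.
move/eqP; rewrite !mulf_eq0 !subr_eq0 => /or3P[] /eqP->.
- by exists ord0; rewrite mul1r.
- by exists 1; rewrite expr1.
by exists ord_max.
Qed.

Lemma ord3_double (j : 'I_3) : j + j = - j.
Proof. by apply: val_inj; case: j => [[|[|[|//]]] ?]. Qed.

Section BiquadraticFacts.

Variables (k : fieldType) (B : biquadratic k).

Local Notation g := (@bq_gal k B).
Local Notation omega := (bq_omega B).
Local Notation theta := (@bq_theta k B).
Local Notation n := (bq_norm B).

Lemma bq_gal_id a : g false false a = a.
Proof. by apply: (fmorph_inj (g false false)); rewrite /= bq_galM. Qed.

Lemma bq_theta_neq0 b : theta b != 0.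
Proof.
have th0 : theta false != 0.
  by apply: contraNneq (@bq_theta_ncube k B 0) => ->; rewrite expr0n.
case: b => //; rewrite -[true]/(true (+) false).
by rewrite -(bq_gal_theta B true false) fmorph_eq0.
Qed.

Lemma bq_norm_neq0 : n != 0.
Proof.
by apply: contraNneq (@bq_norm_ncube k B 0) => ->; rewrite scale0r expr0n.
Qed.

Lemma bq_theta_neq : theta true != theta false.
Proof.
apply: contraNneq (@bq_norm_theta_ncube k B (theta false)) => th.
by rewrite -bq_normE th !exprS expr0; apply/eqP; ring.
Qed.

Lemma bq_omega_neq0 : omega != 0.
Proof.
apply/eqP => om0; have := bq_omegaE B; rewrite om0 expr0n /= !add0r => /eqP.
by rewrite oner_eq0.
Qed.

Lemma bq_omega3 : omega ^+ 3 = 1.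
Proof.
apply/eqP; rewrite -subr_eq0; apply/eqP.
transitivity ((omega - 1) * (omega ^+ 2 + omega + 1)); first by ring.
by rewrite bq_omegaE mulr0.
Qed.

Lemma bq_omega2_neq : omega ^+ 2 != omega.
Proof.
apply: contraNneq (bq_omega_neq1 B) => om2.
by apply/eqP/(mulfI bq_omega_neq0); rewrite mulr1 -expr2.
Qed.

Lemma bq_omega_powD (a b : 'I_3) : omega ^+ (a + b)%R = omega ^+ a * omega ^+ b.
Proof. by rewrite -exprD -[RHS](expr_mod _ bq_omega3). Qed.

Lemma bq_omega_pow_neq (a b : 'I_3) : a != b -> omega ^+ a != omega ^+ b.
Proof.
suff H (c : 'I_3) : c != 0 -> omega ^+ c != 1.
  move=> ab; rewrite -[a](subrK b) bq_omega_powD -[X in _ != X]mul1r.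
  rewrite (inj_eq (mulIf (expf_neq0 _ bq_omega_neq0))) H // subr_eq0 //.
case: c => [[|[|[|//]]] ?] //= _; first by rewrite expr1 bq_omega_neq1.
apply/eqP => om2; have /eqP[] := bq_omega_neq1 B.
by rewrite -[LHS]mulr1 -om2 -exprS bq_omega3.
Qed.

Lemma bq_gal_neq (i j : bool * bool) :
  i != j -> exists a, g i.1 i.2 a != g j.1 j.2 a.
Proof.
case: i j => [t r] [t' r'] /=; have [<-|tt'] := eqVneq t t'.
  rewrite xpair_eqE eqxx /= => rr; exists omega; rewrite !bq_gal_omega.
  move: rr; case: r r' => [] [] //= _; rewrite ?bq_omega2_neq //.
  by rewrite eq_sym bq_omega2_neq.
move=> _; exists (theta false); rewrite !bq_gal_theta.
by move: tt'; case: t t' => [] [] //= _; rewrite ?bq_theta_neq // eq_sym bq_theta_neq.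
Qed.

End BiquadraticFacts.

(** * A Hopf Galois structure on K *)

Section HopfGalois.

Variables (k : fieldType) (B : biquadratic k) (K : pureExt 3 (bq_theta B false)).

Local Notation g := (@bq_gal k B).
Local Notation theta := (@bq_theta k B).
Local Notation n := (bq_norm B).
Local Notation iota := (pure_in K).
Local Notation v := (pure_root K).
Local Notation co := (@pure_coord _ _ _ _ K).
Local Notation I := ('I_3 * bool * bool)%type.

(** The conjugate of v over theta true is nu / v, where nu^3 = n, and nu is not
    in K.  So the automorphisms of E that move theta do not extend to K, but they
    do act on each E v^m once v^m is sent to a multiple of v^-m by a power of nu
    that lies in k. *)
Definition twist_sign (t : bool) (m : 'I_3) : 'I_3 := if t then - m else m.
Definition twist_coef (t : bool) (m : 'I_3) : B :=
  if t && (m != 0) then theta true else 1.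

(** This is v^m if t is false, and otherwise n / v^m, or 1 if m = 0. *)
Definition twist_root t m : K := iota (twist_coef t m) * v ^+ twist_sign t m.

(** Project to the component E v^m, let the automorphism of E given by (t, r)
    act, and land in the line of twist_root t m.  These operators span the
    invariants of the group algebra of N = S3 x C2 under the Galois group, in
    which the elements of N that move theta have been averaged against powers
    of nu. *)
Definition twisted_op (i : I) (x : K) : K :=
  iota (g i.1.2 i.2 (co i.1.1 x)) * twist_root i.1.2 i.1.1.

Lemma twisted_op_exists (i : I) : exists F : 'End(K), forall x,
  F x = twisted_op i x.
Proof.
apply: linear_lfun => a x y.
by rewrite /twisted_op !linearP /= mulrDl scalerAl.
Qed.

Lemma twist_root_neq0 t m : twist_root t m != 0.
Proof.
rewrite mulf_neq0 ?expf_neq0 ?pure_root_neq0 ?bq_theta_neq0 // fmorph_eq0.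
by rewrite /twist_coef; case: ifP; rewrite ?bq_theta_neq0 ?oner_eq0.
Qed.

Definition comp_coef (t t' : bool) (m : 'I_3) : k :=
  if [&& t, t' & m != 0] then n else 1.

Lemma twist_root_comp t r t' m :
  iota (g t r (twist_coef t' m)) * twist_root t (twist_sign t' m) =
  comp_coef t t' m *: twist_root (t (+) t') m.
Proof.
rewrite /twist_root /twist_coef /twist_sign /comp_coef.
have [->|m0] := eqVneq m 0.
  by case: t t' => [] []; rewrite /= ?oppr0 ?eqxx /= !rmorph1 !mul1r scale1r ?oppr0.
case: t' => /=; last by rewrite rmorph1 rmorph1 mul1r andbF addbF /= scale1r m0.
rewrite oppr_eq0 m0 bq_gal_theta opprK !andbT addbT; case: t => /=.
  by rewrite mulrA -rmorphM bq_normE /= rmorph_alg rmorph1 mul1r mulr_algl.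
by rewrite rmorph1 mul1r scale1r.
Qed.

Definition carry (a b : 'I_3) : bool := (3 <= a + b)%N.

(** With u m for twist_root true m, one has (u 1)^2 = n u 2,
    (u 1)(u 2) = n theta' and (u 2)^2 = theta' u 1. *)
Definition mul_coef (t : bool) (a b : 'I_3) : k :=
  if [&& t, a != 0, b != 0 & ~~ ((a == ord_max) && (b == ord_max))] then n else 1.

Lemma twist_root_mul t a b :
  twist_root t a * twist_root t b =
  mul_coef t a b *: (iota (theta t ^+ carry a b) * twist_root t (a + b)).
Proof.
rewrite /twist_root /twist_coef /twist_sign /mul_coef.
have v3 : v ^+ 3 = iota (theta false) := pure_rootX K.
have nE : iota (theta false) * iota (theta true) = n%:A.
  by rewrite -rmorphM bq_normE /= rmorph_alg.
have modE : (((3 - 0) %% 3 = 0)%N * ((3 - 1) %% 3 = 2)%N * ((3 - 2) %% 3 = 1)%N *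
  ((0 + 0) %% 3 = 0)%N * ((0 + 1) %% 3 = 1)%N * ((0 + 2) %% 3 = 2)%N *
  ((1 + 0) %% 3 = 1)%N * ((1 + 1) %% 3 = 2)%N * ((1 + 2) %% 3 = 0)%N *
  ((2 + 0) %% 3 = 2)%N * ((2 + 1) %% 3 = 0)%N * ((2 + 2) %% 3 = 1)%N)%type.
  by do !split.
rewrite -[RHS]mulr_algl.
by case: t; case: a => [[|[|[|//]]] ?]; case: b => [[|[|[|//]]] ?];
  rewrite /carry /= !modE ?(rmorph1, expr0, expr1, scale1r); ring: v3 nE.
Qed.

Lemma twisted_op_mon i a (m : 'I_3) :
  twisted_op i (iota a * v ^+ m) =
  (i.1.1 == m)%:R * (iota (g i.1.2 i.2 a) * twist_root i.1.2 m).
Proof.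
rewrite /twisted_op pure_coordK; case: eqP => [->|_]; first by rewrite !mul1r.
by rewrite !(mul0r, rmorph0).
Qed.

Lemma twisted_op_comp m t r m' t' r' x :
  twisted_op (m, t, r) (twisted_op (m', t', r') x) =
  (m == twist_sign t' m')%:R *
    (comp_coef t t' m' *: twisted_op (m', t (+) t', r (+) r') x).
Proof.
rewrite {2}/twisted_op {1}/twist_root mulrA -rmorphM twisted_op_mon /=.
congr (_ * _); rewrite rmorphM /= bq_galM rmorphM /= -mulrA.
by rewrite twist_root_comp -scalerAr.
Qed.

(** The comultiplication of the twisted operators: the carry in the exponents
    of v is absorbed by twist_root_mul. *)
Lemma twisted_op_mul m t r x y :
  twisted_op (m, t, r) (x * y) =
  \sum_a \sum_b ((a + b == m)%:R / mul_coef t a b) *: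
    (twisted_op (a, t, r) x * twisted_op (b, t, r) y).
Proof.
have lin (i : I) (J : finType) (F : J -> K) :
    twisted_op i (\sum_j F j) = \sum_j twisted_op i (F j).
  have [f fE] : exists f : 'End(K), forall x, f x = twisted_op i x.
    exact: twisted_op_exists.
  by rewrite -fE linear_sum; apply: eq_bigr => j _; apply: fE.
rewrite [x in LHS]pure_coordE [y in LHS]pure_coordE mulr_suml lin.
apply: eq_bigr => a _; rewrite mulr_sumr lin; apply: eq_bigr => b _.
have vab : v ^+ a * v ^+ b = iota (theta false ^+ carry a b) * v ^+ (a + b)%R.
  have := twist_root_mul false a b.
  by rewrite /twist_root /twist_coef /mul_coef /= rmorph1 !mul1r scale1r.
rewrite mulrACA vab -rmorphM mulrA -rmorphM twisted_op_mon /=.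
rewrite [in RHS]/twisted_op /= [in RHS]mulrACA twist_root_mul.
have mul0 : mul_coef t a b != 0.
  by rewrite /mul_coef; case: ifP; rewrite ?bq_norm_neq0 ?oner_eq0.
rewrite eq_sym; case: eqP => _; last by rewrite !mul0r scale0r.
rewrite !rmorphM rmorphXn /= bq_gal_theta addbF.
by rewrite -scalerAr scalerA divfK // scale1r mul1r !mulrA.
Qed.

Lemma sum_triple (V : zmodType) (F : I -> V) :
  \sum_i F i = \sum_m \sum_t \sum_r F (m, t, r).
Proof.
rewrite pair_bigA /= pair_bigA /=.
by apply: eq_bigr => -[[m t] r].
Qed.

Lemma sum_slice (V : zmodType) (F : I -> V) t r :
    (forall m t' r', (t', r') != (t, r) -> F (m, t', r') = 0) ->
  \sum_i F i = \sum_m F (m, t, r).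
Proof.
move=> F0; rewrite sum_triple; apply: eq_bigr => m _.
rewrite (bigD1 t) //= (bigD1 r) //= !big1 ?addr0 // => [t' tt'|r' rr'].
  by apply: big1 => r' _; apply: F0; rewrite xpair_eqE (negPf tt').
by apply: F0; rewrite xpair_eqE (negPf rr') andbF.
Qed.

Definition comul_coef (i a b : I) : k :=
  if ((a.1.2, a.2) == (i.1.2, i.2)) && ((b.1.2, b.2) == (i.1.2, i.2))
  then (a.1.1 + b.1.1 == i.1.1)%:R / mul_coef i.1.2 a.1.1 b.1.1 else 0.

(** For t false, the operators project to the components of a grading by Z/3,
    and inversion changes the sign of the degree; for t true, they are
    combinations of involutions of N. *)
Definition antipode_index (i : I) : I := (twist_sign (~~ i.1.2) i.1.1, i.1.2, i.2).

Lemma sum_comul_coef (m : 'I_3) t r (F : I -> I -> K) :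
  \sum_a \sum_b comul_coef (m, t, r) a b *: F a b =
  \sum_a \sum_b ((a + b == m)%:R / mul_coef t a b) *: F (a, t, r) (b, t, r).
Proof.
rewrite (@sum_slice _ _ t r) => [|a t' r' ne]; last first.
  by apply: big1 => b _; rewrite /comul_coef /= (negPf ne) scale0r.
apply: eq_bigr => a _; rewrite (@sum_slice _ _ t r) => [|b t' r' ne]; last first.
  by rewrite /comul_coef /= (negPf ne) andbF scale0r.
by apply: eq_bigr => b _; rewrite /comul_coef /= !eqxx.
Qed.

Lemma sum_twisted_op1 x : \sum_m twisted_op (m, false, false) x = x.
Proof.
rewrite [RHS]pure_coordE; apply: eq_bigr => m _.
by rewrite /twisted_op /= bq_gal_id /twist_root /twist_coef /= rmorph1 mul1r.
Qed.

Lemma comp_mul_coef t a : comp_coef t t a / mul_coef t (- a) a = 1.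
Proof.
have n0 := bq_norm_neq0 B.
by rewrite /comp_coef /mul_coef; case: t; rewrite ?divr1 //;
  case: a => [[|[|[|//]]] ?] /=; rewrite ?divr1 ?divff.
Qed.

Lemma card_index : #|{: I}| = \dim {:K}.
Proof. by rewrite pure_dim bq_dim !card_prod card_ord card_bool. Qed.

(** On the component of a monomial only the four automorphisms of E are left,
    and Dedekind's theorem applies. *)
Lemma twisted_op_free (s : I -> K) :
  (forall x, \sum_i s i * twisted_op i x = 0) -> forall i, s i = 0.
Proof.
move=> s0 [[m t] r].
suff : s (m, t, r) * twist_root t m = 0.
  by move/eqP; rewrite mulf_eq0 (negPf (twist_root_neq0 t m)) orbF => /eqP.
pose c (tr : bool * bool) := s (m, tr.1, tr.2) * twist_root tr.1 m.
rewrite -[LHS]/(c (t, r)); move: (t, r).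
have chi_neq (i j : bool * bool) : i != j ->
    exists a, (iota \o g i.1 i.2) a != (iota \o g j.1 j.2) a.
  by move=> ij; have [a ne] := bq_gal_neq B ij; exists a; rewrite /= fmorph_eq.
apply: (@dedekind_independence _ B K (fun tr => iota \o g tr.1 tr.2) chi_neq c).
move=> a; rewrite -[RHS](s0 (iota a * v ^+ m)) sum_triple.
rewrite [RHS](bigD1 m) //= [X in _ + X]big1 ?addr0 => [|m' ne]; last first.
  apply: big1 => t' _; apply: big1 => r' _.
  by rewrite twisted_op_mon /= (negPf ne) mul0r mulr0.
rewrite pair_bigA; apply: eq_bigr => -[t' r'] _ /=.
by rewrite twisted_op_mon eqxx mul1r /c /=; ring.
Qed.

Lemma twisted_hopf_galois : hopf_galois K.
Proof.
have /fin_all_exists[E EE] (i : I) : exists F : 'End(K), forall x, F x = twisted_op i x.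
  exact: twisted_op_exists.
apply: (@hopf_galois_of_operators _ _ _ E _ _ _ comul_coef
  (fun i => (i.1.1 == 0)%:R) antipode_index card_index).
- move=> s s0; apply: twisted_op_free => x; rewrite -[RHS](s0 x).
  by apply: eq_bigr => i _; rewrite EE.
- move=> [[m t] r] [[m' t'] r'].
  exists (fun l => if l == (m', t (+) t', r (+) r')
                   then (m == twist_sign t' m')%:R * comp_coef t t' m' else 0).
  move=> x; rewrite !EE twisted_op_comp (bigD1 (m', t (+) t', r (+) r')) //= eqxx.
  rewrite big1 ?addr0 => [|l /negPf->]; last by rewrite scale0r.
  rewrite EE -scalerA; case: eqP => _; last by rewrite scale0r mul0r.
  by rewrite scale1r mul1r.
- exists (fun i => (~~ i.1.2 && ~~ i.2)%:R) => x.
  rewrite (@sum_slice _ _ false false) => [|m t r ne]; last first.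
    by move: ne; case: t r => [] [] //= _; rewrite scale0r.
  rewrite -[RHS]sum_twisted_op1; apply: eq_bigr => m _.
  by rewrite scale1r EE.
- move=> [[m t] r] x y; rewrite EE twisted_op_mul sum_comul_coef.
  by apply: eq_bigr => a _; apply: eq_bigr => b _; rewrite !EE.
- move=> [[m t] r]; rewrite EE /=.
  transitivity (twisted_op (m, t, r) (iota 1 * v ^+ (ord0 : 'I_3))).
    by rewrite rmorph1 mul1r.
  rewrite twisted_op_mon /= -[ord0]/(0 : 'I_3).
  case: eqP => _; last by rewrite mul0r scale0r.
  rewrite /twist_root /twist_coef /twist_sign eqxx andbF !rmorph1 !mul1r scale1r.
  by case: t; rewrite ?oppr0.
- move=> [[m t] r] x; rewrite sum_comul_coef exchange_big /=.
  rewrite -[in RHS](sum_twisted_op1 x) scaler_sumr; apply: eq_bigr => b _.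
  rewrite (bigD1 (- b)) //= big1 ?addr0 => [|a ab]; rewrite !EE /antipode_index /=.
    rewrite twisted_op_comp addNr (eq_sym 0).
    have [_|_] := eqVneq m 0; last by rewrite mul0r !scale0r.
    have -> : twist_sign (~~ t) (- b) == twist_sign t b.
      by rewrite /twist_sign; case: (t); rewrite ?opprK.
    by rewrite !mul1r scalerA !addbb mulrC comp_mul_coef.
  rewrite twisted_op_comp.
  have [ab0|_] := eqVneq (twist_sign (~~ t) a) (twist_sign t b); last first.
    by rewrite mul0r scaler0.
  case/eqP: ab; move: ab0; rewrite /twist_sign; case: t => /=; first by [].
  by move=> <-; rewrite opprK.
move=> [[m t] r] x; rewrite sum_comul_coef exchange_big /=.
have sign_inj : injective (twist_sign (~~ t)).
  by rewrite /twist_sign; case: (t) => //; apply: oppr_inj.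
rewrite -[in RHS](sum_twisted_op1 x) scaler_sumr [RHS](reindex_inj sign_inj).
apply: eq_bigr => b _.
rewrite (bigD1 (- b)) //= big1 ?addr0 => [|a ab]; rewrite !EE /antipode_index /=.
  rewrite twisted_op_comp addNr (eq_sym 0).
  have [_|_] := eqVneq m 0; last by rewrite mul0r !scale0r.
  have -> : - b == twist_sign t (twist_sign (~~ t) b).
    by rewrite /twist_sign; case: (t); rewrite ?opprK.
  have -> : comp_coef t t (twist_sign (~~ t) b) = comp_coef t t b.
    by rewrite /comp_coef /twist_sign; case: (t).
  by rewrite !mul1r scalerA !addbb mulrC comp_mul_coef.
rewrite twisted_op_comp.
have [ab0|_] := eqVneq a (twist_sign t (twist_sign (~~ t) b)); last first.
  by rewrite mul0r scaler0.
by case/eqP: ab; rewrite ab0 /twist_sign; case: (t).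
Qed.

End HopfGalois.

(** * The embeddings of K and the failure of bijectivity *)

Local Notation I := ('I_3 * bool * bool)%type.

(** The index of x i after the involution of K that sends v to omega^j v and
    omega to its inverse. *)
Definition reflect_index (j : 'I_3) (i : I) : I :=
  (i.1.1 + twist_sign i.2 j, i.1.2, ~~ i.2).

(** The index of the composite of x i with the automorphism of L over K that
    multiplies nu by omega. *)
Definition kummer_index (i : I) : I :=
  (if i.1.2 then i.1.1 + 1 else i.1.1, i.1.2, i.2).

Lemma kummer_index_inj : injective kummer_index.
Proof.
move=> [[m t] r] [[m' t'] r'] /eqP; rewrite !xpair_eqE /=.
move=> /andP[/andP[/eqP e /eqP tt'] /eqP <-]; move: e; rewrite -tt'.
by case: (t) => [/addIr|] ->.
Qed.

Section Embeddings.

Variables (k : fieldType) (B : biquadratic k) (K : pureExt 3 (bq_theta B false)).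

Local Notation g := (@bq_gal k B).
Local Notation theta := (@bq_theta k B).
Local Notation omega := (bq_omega B).
Local Notation n := (bq_norm B).
Local Notation iota := (pure_in K).
Local Notation v := (pure_root K).
Local Notation co := (@pure_coord _ _ _ _ K).

(** The automorphism c of K over E multiplies v by omega.  A cube root of n in K
    is an eigenvector of c, hence of the form f v^j with f in E, and each j
    contradicts one of the conditions of a biquadratic field. *)
Lemma norm_ncube (nu : K) : nu ^+ 3 != n%:A.
Proof.
apply/negP => /eqP nu3.
have [|c [c_in c_v]] := @pure_lift _ _ _ _ K isT K iota (iota omega * v).
  by rewrite exprMn -rmorphXn bq_omega3 rmorph1 mul1r pure_rootX.
have omK : iota omega ^+ 2 + iota omega + 1 = 0.
  by rewrite -rmorphXn -rmorphD -(rmorph1 iota) -rmorphD bq_omegaE rmorph0.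
have [|j cnu] := @cube_eq K (iota omega) (c nu) nu omK.
  by rewrite -rmorphXn nu3 /= rmorph_alg.
have co_c i : co i (c nu) = omega ^+ i * co i nu.
  rewrite [nu in LHS]pure_coordE rmorph_sum linear_sum (bigD1 i) //= big1 ?addr0.
    rewrite rmorphM rmorphXn /= c_in c_v exprMn mulrCA -rmorphXn pure_coordZ.
    by rewrite pure_coordK eqxx mul1r.
  move=> l li; rewrite rmorphM rmorphXn /= c_in c_v exprMn mulrCA -rmorphXn.
  by rewrite pure_coordZ pure_coordK eq_sym (negPf li) mul0r mulr0.
have co0 i : i != j -> co i nu = 0.
  move=> ij; have := co_c i; rewrite cnu -rmorphXn pure_coordZ => /eqP.
  rewrite -subr_eq0 -mulrBl mulf_eq0 subr_eq0 => /orP[|/eqP//].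
  by rewrite eq_sym (negPf (bq_omega_pow_neq B ij)).
have nuE : nu = iota (co j nu) * v ^+ j.
  rewrite [LHS]pure_coordE (bigD1 j) //= big1 ?addr0 // => i /co0->.
  by rewrite rmorph0 mul0r.
have th_nth : theta false != 0 := bq_theta_neq0 B false.
have nE : co j nu ^+ 3 * theta false ^+ j = n%:A.
  apply: (fmorph_inj iota); rewrite rmorphM !rmorphXn /= -pure_rootX rmorph_alg.
  by rewrite -nu3 [in RHS]nuE [in RHS]exprMn -!exprM mulnC.
move: (co j nu) nE => f; case: j {cnu co0 nuE} => [[|[|[|//]]] ?] /= nE.
- by have /eqP[] := bq_norm_ncube f; rewrite -nE mulr1.
- have f3 : f ^+ 3 = theta true by apply: (mulfI th_nth); rewrite bq_normE -nE mulrC.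
  have /eqP[] := bq_theta_ncube (g true false f).
  by rewrite -rmorphXn f3 /= bq_gal_theta.
have /eqP[] := bq_norm_theta_ncube (f * theta false).
by rewrite -nE; ring.
Qed.

Variable L : pureExt (E := K) 3 n%:A.

Local Notation jota := (pure_in L).
Local Notation nu := (pure_root L).

(** The cube roots of the two conjugates of theta in L = K(nu), nu^3 = n. *)
Definition conj_root (t : bool) : L := if t then nu / jota v else jota v.

Lemma conj_root_neq0 t : conj_root t != 0.
Proof.
have v0 : jota v != 0 by rewrite fmorph_eq0 pure_root_neq0 ?bq_theta_neq0.
rewrite /conj_root; case: t => //; rewrite mulf_neq0 ?invr_eq0 // pure_root_neq0 //.
by rewrite scaler_eq0 negb_or bq_norm_neq0 oner_neq0.
Qed.

Lemma conj_root3 t : conj_root t ^+ 3 = jota (iota (theta t)).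
Proof.
rewrite /conj_root; case: t; last by rewrite -rmorphXn pure_rootX.
have nE : jota n%:A = jota (iota (theta false)) * jota (iota (theta true)).
  by rewrite -!rmorphM bq_normE /= !rmorph_alg.
rewrite expr_div_n pure_rootX -rmorphXn pure_rootX nE /= mulrC mulKf //.
by rewrite !fmorph_eq0 bq_theta_neq0.
Qed.

Let iota_omega3 : iota omega ^+ 3 = 1.
Proof. by rewrite -rmorphXn bq_omega3 rmorph1. Qed.

Let jota_omega3 : jota (iota omega) ^+ 3 = 1.
Proof. by rewrite -rmorphXn iota_omega3 rmorph1. Qed.

Lemma embedding_exists (i : I) : exists x : {lrmorphism K -> L},
  (forall a, x (iota a) = jota (iota (g i.1.2 i.2 a))) /\
  x v = jota (iota omega) ^+ i.1.1 * conj_root i.1.2.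
Proof.
have [|x [x_in x_v]] := @pure_lift _ _ _ _ K isT L (jota \o (iota \o g i.1.2 i.2))
    (jota (iota omega) ^+ i.1.1 * conj_root i.1.2).
  rewrite exprMn exprAC jota_omega3 expr1n mul1r conj_root3 /=.
  by rewrite bq_gal_theta addbF.
by exists x.
Qed.

Lemma reflection_exists (j : 'I_3) : exists rho : {lrmorphism K -> K},
  (forall a, rho (iota a) = iota (g false true a)) /\ rho v = iota omega ^+ j * v.
Proof.
have [|x [x_in x_v]] := @pure_lift _ _ _ _ K isT K (iota \o g false true)
    (iota omega ^+ j * v).
  rewrite exprMn exprAC iota_omega3 expr1n mul1r /=.
  by rewrite bq_gal_theta pure_rootX.
by exists x.
Qed.

Variables (x : I -> {lrmorphism K -> L}).
Hypothesis x_in : forall i a, x i (iota a) = jota (iota (g i.1.2 i.2 a)).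
Hypothesis x_v : forall i, x i v = jota (iota omega) ^+ i.1.1 * conj_root i.1.2.

Let omega_pow (a : 'I_3) : jota (iota omega) ^+ a = jota (iota (omega ^+ a)).
Proof. by rewrite rmorphXn /= rmorphXn. Qed.

Lemma embeddings_neq i j : i != j -> exists a, x i a != x j a.
Proof.
case: i j => [[m t] r] [[m' t'] r'] ij.
have [[tt' rr']|tr] := eqVneq (t, r) (t', r').
  subst t' r'; exists v; rewrite !x_v /=.
  rewrite (inj_eq (mulIf (conj_root_neq0 _))) !omega_pow !fmorph_eq.
  apply: bq_omega_pow_neq; apply: contraNneq ij => ->; exact: eqxx.
by have [a ne] := bq_gal_neq B tr; exists (iota a); rewrite !x_in !fmorph_eq.
Qed.

(** As K has degree 2 over the field fixed by the reflection, an embedding of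
    this field has two extensions to K.  The elements theta and omega^-j v of the
    field are enough to tell the other embeddings apart. *)
Lemma reflection_fixed_agree (j : 'I_3) (rho : {lrmorphism K -> K}) i i' :
    (forall a, rho (iota a) = iota (g false true a)) ->
    rho v = iota omega ^+ j * v ->
    (forall a, rho a = a -> x i a = x i' a) ->
  i' = i \/ i' = reflect_index j i.
Proof.
case: i i' => [[m t] r] [[m' t'] r'] rho_in rho_v agree.
have tt' : t = t'.
  have := agree (iota (theta false)); rewrite rho_in bq_gal_theta => /(_ erefl).
  rewrite !x_in !bq_gal_theta !addbF /= => /fmorph_inj/fmorph_inj.
  have := bq_theta_neq B; clear agree.
  case: t t' => [] [] // ne /eqP; first by rewrite (negPf ne).
  by rewrite eq_sym (negPf ne).
rewrite -{}tt' in agree *.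
have [a aE] : exists a : 'I_3, a = - j by exists (- j).
have := agree (iota (omega ^+ a) * v).
have om_gal t1 r1 (b : 'I_3) : g t1 r1 (omega ^+ b) = omega ^+ (twist_sign r1 b).
  rewrite rmorphXn /= bq_gal_omega /twist_sign; case: r1 => //.
  rewrite -exprM; apply: (mulIf (expf_neq0 b (bq_omega_neq0 B))).
  by rewrite -bq_omega_powD addNr -exprD addnC -mulSn exprM bq_omega3 expr1n.
rewrite rmorphM /= rho_in rho_v om_gal mulrA -rmorphXn -rmorphM -bq_omega_powD.
rewrite {1}/twist_sign {1}aE opprK ord3_double -aE => /(_ erefl).
rewrite !rmorphM /= !x_in !om_gal !x_v /= !mulrA !omega_pow.
move/(mulIf (conj_root_neq0 _)); rewrite -!rmorphM -!bq_omega_powD.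
move=> /fmorph_inj/fmorph_inj/eqP.
have [e _ | /bq_omega_pow_neq/negPf-> //] :=
  eqVneq (twist_sign r a + m) (twist_sign r' a + m').
rewrite /reflect_index /=; case: r r' e {agree} => [] [] /=;
  rewrite /twist_sign aE ?opprK.
- by move/addrI ->; left.
- move=> e; right; congr (_, _, _).
  by rewrite -[m'](addKr (- j)) -e opprK addrA ord3_double addrC.
- move=> e; right; congr (_, _, _).
  by rewrite -[m'](addKr j) -e addrA -opprD ord3_double opprK addrC.
by move/addrI ->; left.
Qed.

Lemma kummer_automorphism : exists sigma : {lrmorphism L -> L},
  forall i a, sigma (x i a) = x (kummer_index i) a.
Proof.
have [|s [s_in s_nu]] := @pure_lift _ _ _ _ L isT L jota (jota (iota omega) * nu).
  by rewrite exprMn jota_omega3 mul1r pure_rootX.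
exists s => i; apply: (@pure_hom_eq _ _ _ _ K L (s \o x i)) => [a|] /=.
  by rewrite !x_in s_in.
case: i => [[m t] r]; rewrite !x_v /kummer_index /fst /snd rmorphM rmorphXn /= s_in.
rewrite /conj_root; case: t; last by rewrite s_in.
rewrite rmorphM fmorphV /= s_in s_nu (omega_pow (m + 1)) bq_omega_powD expr1.
by rewrite !rmorphM /= !rmorphXn /=; ring.
Qed.

End Embeddings.

Section NoBijectiveCorrespondence.

Variables (k : fieldType) (B : biquadratic k) (K : pureExt 3 (bq_theta B false)).
Variable L : pureExt (E := K) 3 (bq_norm B)%:A.
Variable S : hopfGaloisStructure K.

(** Let Gamma be the group of order 6 generated by the three reflections of K.
    Their fixed fields being in the image, Gamma is contained in N, with index
    2.  An element of N outside Gamma takes x0 to y; it acts on the orbit of x0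
    under Gamma, which the Kummer automorphism fixes, with values in the orbit
    of y, which the Kummer automorphism translates by an element of order 3 of
    Gamma.  This element would have to be central in Gamma = S3. *)
Lemma no_bijective_correspondence : ~ galois_correspondence_bijective S.
Proof.
move=> bij.
have /fin_all_exists[x xE] := embedding_exists L.
have x_in i := (xE i).1; have x_v i := (xE i).2.
have x_neq := embeddings_neq x_in x_v.
have card_I := card_index K.
have [c cE] := coefficient_table_exists S card_I x_neq.
pose same i y i' y' := forall h, c i y h = c i' y' h.
have row_inj i y z : same i y i z -> y = z by exact: (coefficient_row_inj x_neq cE).
have transfer i y i' : exists y', same i y i' y' :=
  coefficient_transfer card_I x_neq cE i y i'.
have unit i y z : same i i y z -> y = z by exact: (coefficient_unit x_neq cE).
have comp i y z i' y' z' : same i y i' y' -> same y z y' z' -> same i z i' z'.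
  by move=> s1 s2; apply: (coefficient_comp card_I x_neq cE s1 s2).
have [s sE] := kummer_automorphism x_in x_v.
(* The element of N that moves i to y preserves the pairs of embeddings that
   agree on the field fixed by the reflection, hence exchanges them. *)
have reflect j i i' : same i (reflect_index j i) i' (reflect_index j i').
  have [rho [rho_in rho_v]] := reflection_exists K j.
  have [A [hopfA fixA]] := bij (fixedSpace (linfun rho))%AS.
  have fixP a : rho a = a -> a \in hopf_fixed A.
    by rewrite fixA => ra; apply/fixedSpaceP; rewrite lfunE.
  have A_neq : hopf_fixed A != fullv.
    rewrite fixA; apply/eqP => fix_full.
    have : pure_in K (bq_omega B) \in fixedSpace (linfun rho) by rewrite fix_full memvf.
    move/fixedSpaceP; rewrite lfunE /= rho_in bq_gal_omega => /fmorph_inj/eqP.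
    by rewrite (negPf (bq_omega2_neq B)).
  have [a [y [aA y_neq cy]]] := coefficient_nontrivial cE (ord0, false, false) A_neq.
  suff H i1 : same (ord0, false, false) y i1 (reflect_index j i1).
    by move=> h; rewrite -!H.
  have [y1 sy1] := transfer (ord0, false, false) y i1.
  have : y1 = i1 \/ y1 = reflect_index j i1.
    apply: (reflection_fixed_agree x_in x_v rho_in rho_v) => b /fixP bA.
    by apply: (coefficient_support x_neq cE hopfA aA bA); rewrite -sy1.
  case=> y1E; last by rewrite -y1E.
  case/eqP: y_neq; apply/esym/(unit i1) => h.
  by rewrite sy1 y1E.
(* Gamma acts simply transitively on the embeddings with the same t. *)
have translate i i' y : i.1.2 = i'.1.2 -> exists y', y'.1.2 = y.1.2 /\ same i i' y y'.
  case: i i' => [[m t] r] [[m' t'] r'] /= <- {t'}.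
  have step (m1 : 'I_3) r1 :
      reflect_index (twist_sign r1 (m' - m1)) (m1, t, r1) = (m', t, ~~ r1).
    rewrite /reflect_index /=; congr (_, _, _).
    by rewrite /twist_sign; case: r1; rewrite ?opprK addrC subrK.
  have [rr|rr] := eqVneq r' r.
    exists (reflect_index (twist_sign (~~ r) (m' - m)) (reflect_index 0 y)); split=> //.
    rewrite {}rr; have := step m (~~ r); rewrite negbK => <-.
    have -> : (m, t, ~~ r) = reflect_index 0 (m, t, r).
      by rewrite /reflect_index /= /twist_sign; case: (r); rewrite ?oppr0 addr0.
    by apply: comp; apply: reflect.
  exists (reflect_index (twist_sign r (m' - m)) y); split=> //.
  have -> : r' = ~~ r by move: rr; case: (r) (r') => [] [].
  by rewrite -(step m r); apply: reflect.
pose x0 : I := (0, false, false).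
pose y : I := (0, true, false).
pose y1 : I := (0, true, true).
(* One element of N moves x0 to y and x1 to y1; as it is not in Gamma, x1 is
   fixed by the Kummer automorphism, like x0. *)
have [x1 sx1] : exists x1, same x0 y x1 y1.
  have [x1 s1] := transfer y x0 y1.
  have [y2 s2] := transfer x0 y x1.
  by exists x1; rewrite (unit _ _ _ (comp _ _ _ _ _ _ s1 s2)).
have x1t : x1.1.2 = false.
  case x1t : x1.1.2 => //.
  have [z [zt sz]] := translate x1 y1 x0 x1t.
  have yz : y = z by apply: (row_inj x0) => h; rewrite sx1 sz.
  by move: zt; rewrite -yz.
have sigma i z i' z' : same i z i' z' ->
    same (kummer_index i) (kummer_index z) (kummer_index i') (kummer_index z').
  have sc u w h : c (kummer_index u) (kummer_index w) h = s (c u w h).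
    rewrite -[w](invF_f kummer_index_inj); move: (kummer_index w) => {}w.
    rewrite f_invF; move: w; apply: (embeddings_eq x_neq) => b.
    rewrite -cE -sE cE rmorph_sum [RHS](reindex_inj kummer_index_inj).
    by apply: eq_bigr => z1 _; rewrite rmorphM /= sE invF_f.
  by move=> h0 h; rewrite !sc h0.
have := sigma _ _ _ _ sx1; case: x1 x1t sx1 => [[m1 t1] r1] /= -> sx1 sig.
(* The rotation composed of the reflections 1 and 0 moves y like the Kummer
   automorphism, but moves y1 the other way. *)
have via z : reflect_index 0 (reflect_index 1 (0, true, z)) = (twist_sign z 1, true, z).
  rewrite /reflect_index /twist_sign.
  by case: z; rewrite /fst /snd /negb ?oppr0 add0r addr0.
have sy2 : same x0 (twist_sign false 1, true, false)
                (m1, false, r1) (twist_sign true 1, true, true).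
  rewrite -!via; apply: (comp _ _ _ _ _ _ (comp _ _ _ _ _ _ sx1 _)); apply: reflect.
have : (1, true, true) = (-1, true, true) :> I.
  apply: (row_inj (m1, false, r1)) => h.
  transitivity (c x0 (1, true, false) h); last exact: sy2.
  by have := sig h; rewrite /kummer_index /fst /snd !add0r => <-.
by case.
Qed.

End NoBijectiveCorrespondence.

Theorem theorem5p4 :
  exists (k : fieldType) (K : fieldExtType k),
    [/\ separable 1%VS {:K}%VS,
        hopf_galois K &
        forall S : hopfGaloisStructure K, ~ galois_correspondence_bijective S].
Proof.
have [B] := biquadratic_exists.
have [K] : inhabited (pureExt 3 (bq_theta B false)).
  apply: pureExt_exists => //; apply: XnsubC_irreducible => // a.
  exact: bq_theta_ncube.
have [L] : inhabited (pureExt (E := K) 3 (bq_norm B)%:A).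
  apply: pureExt_exists => //; apply: XnsubC_irreducible => // a.
  exact: norm_ncube.
exists rat, K; split; first 1 last.
- exact: twisted_hopf_galois.
- by move=> S; apply: (no_bijective_correspondence L).
apply/separableP => u _; apply: pcharf0_separable => p.
by rewrite pchar_lalg pchar_num.
Qed.
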